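(* Let $M,L_{cdf}>0$, let $K\ge2$ and let $(w_s)_{s\in[K]}$ be positive weights summing to $1$. Let $\mathcal P(M,L_{cdf})$ be the class of data-generating distributions defined in the context. Then there exists a constant $C_{MSE}>0$ depending only on $M$, $L_{cdf}$ and $(w_s)_s$ such that for every $n\geq 1$, $$\inf_{\widehat f_n}\ \sup_{\mathbb P\in\mathcal P(M,L_{cdf})}\ \mathbb E\big[\|\widehat f_n-f_0^*\|^2\big]\ \ge\ C_{MSE}\,n^{-1/3},$$ where the infimum is over all estimators $\widehat f_n$ built from an i.i.d. sample of size $n$ from $\mathbb P$ and $f_0^*$ is the optimal counterfactually fair predictor under $\mathbb P$.
   Context: Data-generating distributions: $\mathbb P$ is the law of $(\mathbf X,V,S,Y)\in\mathbb R^d\times[0,1]\times[K]\times\mathbb R$ with $\mathbb P(S=s)=w_s$, $V\sim\mathrm{Unif}[0,1]$ independent of $S$, and $V=\psi(\mathbf X,S)$ a.s. for some measurable $\psi$. Let $f^*(\mathbf X,S)=\mathbb E[Y\mid\mathbf X,S]$, and for a predictor $f$ let $\mu_{f\mid v,s}$ be the conditional law of $f(\mathbf X,S)$ given $V=v,S=s$, with c.d.f. $F_{f\mid v,s}$ and quantile function $F^{-1}_{f\mid v,s}$ (generalized inverse). $\mathcal P(M,L_{cdf})$ is the class of such $\mathbb P$ for which: (a) for all $(v,s)$, $\mu_{f^*\mid v,s}$ is non-atomic and supported in $[-M,M]$; (b) for all $s\in[K]$, $t\in\mathbb R$, the map $v\mapsto F_{f^*\mid v,s}(t)$ is $L_{cdf}$-Lipschitz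 on $[0,1]$. The optimal fair predictor is the minimizer of $\mathbb E[(f(\mathbf X,S)-f^*(\mathbf X,S))^2]$ over measurable $f$ such that, for almost every $v$, the laws $\mu_{f\mid v,s}$, $s\in[K]$, coincide; explicitly $$f_0^*(\mathbf x,s)=\Big(\sum_{s'}w_{s'}F^{-1}_{f^*\mid v,s'}\Big)\circ F_{f^*\mid v,s}(f^*(\mathbf x,s)),\quad v=\psi(\mathbf x,s).$$ An estimator $\widehat f_n$ is a (measurable) map from the sample $(\mathbf X_i,V_i,S_i,Y_i)_{i=1}^n$ to predictors $\mathbb R^d\times[K]\to\mathbb R$. $\|g\|^2=\mathbb E[g(\mathbf X,S)^2]$ for $(\mathbf X,S)$ a fresh draw from $\mathbb P$, and the outer expectation is over the sample. *)

(* Defs.v *)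
From HB Require Import structures.
From mathcomp Require Import all_boot all_order all_algebra.
From mathcomp Require Import all_classical all_reals all_analysis.

Set Implicit Arguments.
Unset Strict Implicit.
Unset Printing Implicit Defensive.

Import Order.TTheory GRing.Theory Num.Theory.
Import numFieldNormedType.Exports.

Local Open Scope classical_set_scope.
Local Open Scope ring_scope.

(* Measurable types are pointed, which rules out 'I_0: the set of attributes
   [K], for K >= 2, is 'I_k.+2 with k = K - 2 below. *)
HB.instance Definition _ (n : nat) := isPointed.Build 'I_n.+1 ord0.
HB.instance Definition _ (n : nat) :=
  @isMeasurable.Build default_measure_display 'I_n.+1 discrete_measurable
    discrete_measurable0 discrete_measurableC discrete_measurableU.

Section iid_sample.
Context {dT : measure_display} {T : measurableType dT} {R : realType}.

Definition tcons n (z : T * n.-tuple T) : n.+1.-tuple T :=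
  [tuple of z.1 :: z.2].

Lemma measurable_tcons n : measurable_fun [set: T * n.-tuple T] (@tcons n).
Proof. exact: measurable_cons. Qed.

HB.instance Definition _ n :=
  isMeasurableFun.Build _ _ _ _ (@tcons n) (@measurable_tcons n).

(* The n-fold product measure, characterised by iid_law_box. *)
Fixpoint iid_law (P : probability T R) n : probability (n.-tuple T) R :=
  match n with
  | 0 => \d_([tuple] : 0.-tuple T)
  | m.+1 => distribution (P \x iid_law P m)%E (@tcons m)
  end.

Lemma iid_law_box (P : probability T R) n (A : 'I_n -> set T) :
  (forall i, measurable (A i)) ->
  iid_law P n [set t | forall i, A i (tnth t i)] = (\prod_(i < n) P (A i))%E.
Proof.
elim: n A => [|n IH] A mA.
  by rewrite big_ord0 /= diracE mem_set// => -[].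
rewrite big_ord_recl -IH; last by move=> i; exact: mA.
have mB : measurable
    [set t : n.-tuple T | forall i, A (lift ord0 i) (tnth t i)].
  rewrite [X in measurable X](_ : _ = \bigcap_(i in [set: 'I_n])
      (fun t : n.-tuple T => tnth t i) @^-1` A (lift ord0 i)); last first.
    by apply/seteqP; split=> t /= h i => [_|]; exact: h.
  apply: fin_bigcap_measurable => // i _.
  by rewrite -[X in measurable X]setTI; exact: measurable_tnth.
rewrite -product_measure1E//= /distribution /pushforward.
congr (product_measure1 _ _ _).
apply/seteqP; split => -[z t] /=.
  move=> h; split; first by have := h ord0.
  by move=> i; have := h (lift ord0 i); rewrite tnthS.
move=> [h0 h1] i; case: (unliftP ord0 i) => [j ->|->]; last exact: h0.
by rewrite tnthS; exact: h1.
Qed.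

End iid_sample.

Section counterfactual_fairness.
Context {R : realType} {d k : nat}.

(* An observation is z = (((x, v), s), y); R^d carries the product of the
   Borel sigma-algebras. *)
Local Notation attribute := 'I_k.+2.
Local Notation covariate := (d.-tuple R * attribute)%type.
Local Notation observation := (d.-tuple R * R * attribute * R)%type.

Definition obsX (z : observation) : d.-tuple R := z.1.1.1.
Definition obsV (z : observation) : R := z.1.1.2.
Definition obsS (z : observation) : attribute := z.1.2.
Definition obsY (z : observation) : R := z.2.
Definition obsXS (z : observation) : covariate := (obsX z, obsS z).
Definition obsVS (z : observation) : R * attribute := (obsV z, obsS z).

Implicit Types (P : probability observation R) (f g : covariate -> R).

Definition is_regression P f : Prop :=
  [/\ measurable_fun [set: covariate] f,
      P.-integrable setT (fun z => (obsY z)%:E),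
      P.-integrable setT (fun z => (f (obsXS z))%:E) &
      forall A : set covariate, measurable A ->
        (\int[P]_(z in obsXS @^-1` A) (f (obsXS z))%:E =
         \int[P]_(z in obsXS @^-1` A) (obsY z)%:E)%E].

(* mu is a version of the regular conditional law of f(X, S) given (V, S):
   mu (v, s) is the law of f(X, S) given V = v and S = s. *)
Definition is_cond_law P f (mu : R.-pker (R * attribute) ~> R) : Prop :=
  forall (A : set (R * attribute)) (B : set R), measurable A -> measurable B ->
    (P ((obsVS @^-1` A) `&` ((fun z => f (obsXS z)) @^-1` B)) =
     \int[P]_(z in obsVS @^-1` A) mu (obsVS z) B)%E.

Definition cond_cdf (mu : R.-pker (R * attribute) ~> R) (v : R) (s : attribute)
  (t : R) : R := fine (mu (v, s) `]-oo, t]%classic).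

Definition data_generating (w : attribute -> R) P : Prop :=
  [/\ forall s, P (obsS @^-1` [set s]) = (w s)%:E,
      forall A, measurable A ->
        P (obsV @^-1` A) = uniform_prob (@ltr01 R) A,
      forall (A : set R) (B : set attribute), measurable A -> measurable B ->
        P ((obsV @^-1` A) `&` (obsS @^-1` B)) =
          (P (obsV @^-1` A) * P (obsS @^-1` B))%E &
      exists2 psi : covariate -> R, measurable_fun [set: covariate] psi &
        {ae P, forall z, obsV z = psi (obsXS z)}].

(* Conditional laws are only determined for almost every v, so the conditions
   are required of some version; when all w s are positive, the Lipschitz
   condition makes that version unique for v in [0, 1]. *)
Definition lipschitz_class (w : attribute -> R) (M L : R) P : Prop :=
  data_generating w P /\
  exists f mu,
    [/\ is_regression P f,
        is_cond_law P f mu,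
        forall v s, v \in `[0, 1] ->
          (forall t, mu (v, s) [set t] = 0%E) /\
          mu (v, s) `[- M, M]%classic = 1%E &
        forall s t, L.-lipschitz_(`[0, 1]%classic) (fun v => cond_cdf mu v s t)].

Definition fair P f : Prop :=
  exists2 mu, is_cond_law P f mu &
    {ae uniform_prob (@ltr01 R), forall v, forall s s' B, measurable B ->
      mu (v, s) B = mu (v, s') B}.

(* The squared L2 distance || f - g ||^2, possibly infinite. *)
Definition sqdist P f g : \bar R :=
  (\int[P]_z ((f (obsXS z) - g (obsXS z)) ^+ 2)%:E)%E.

(* A least-squares projection of the regression function onto the fair
   predictors. *)
Definition optimal_fair P f0 : Prop :=
  [/\ measurable_fun [set: covariate] f0, fair P f0 &
      exists2 fstar, is_regression P fstar &
        forall f, measurable_fun [set: covariate] f -> fair P f ->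
          (sqdist P f0 fstar <= sqdist P f fstar)%E].

(* Estimators are jointly measurable in the sample and in the argument of the
   predictor they return. *)
Definition estimator n (fhat : n.-tuple observation -> covariate -> R) : Prop :=
  measurable_fun [set: n.-tuple observation * covariate]
    (fun u => fhat u.1 u.2).

Definition risk n (fhat : n.-tuple observation -> covariate -> R) P f0 :
  \bar R := (\int[iid_law P n]_D sqdist P (fhat D) f0)%E.

(* On lipschitz_class the fair optimum f0 exists and is unique P-a.s., so that
   the supremum over pairs (P, f0) is the supremum over P. *)
Definition worst_risk (w : attribute -> R) (M L : R) n
    (fhat : n.-tuple observation -> covariate -> R) : \bar R :=
  ereal_sup [set r | exists P f0,
    [/\ lipschitz_class w M L P, optimal_fair P f0 & r = risk fhat P f0]].

Definition minimax_risk (w : attribute -> R) (M L : R) n : \bar R :=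
  ereal_inf [set worst_risk w M L fhat | fhat in @estimator n].

End counterfactual_fairness.

(* Main.v *)
(* The lower bound is an instance of Assouad's lemma. All groups but the first have the
   uniform conditional law on [0, c], c = M / 2. In the first group, given V = v, f* has
   density (1 - delta v) / c on [0, c/2] and (1 + delta v) / c on [3c/2, 2c], so its
   quantile function jumps by c at level (1 - delta v) / 2, and the fair optimum, as a
   function of the common level, jumps by c * w at the same place. Cut [0, 1] into
   m ~ n^(1/3) cells and let delta be, on the j-th cell, a tent of height l / (2m) with
   sign e_j. Flipping e_j moves the fair optimum by at least c * w on a set of measure of
   order 1 / m^2, while the Hellinger affinity of the two laws is 1 - O(1 / m^3), so that
   n ~ m^3 observations do not tell them apart; the m cells contribute m * m^-2 ~ n^(-1/3).

   The explicit fair predictor is optimal by a dual certificate: a function of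
   (V, S, f(X, S)) built from the Brenier potential of the barycenter has the same mean for
   all fair f, and adding it to the squared error makes the barycenter a pointwise
   minimizer. Responses are noiseless, Y = f*(X, S). *)

Require Import Defs.
From HB Require Import structures.
From mathcomp Require Import all_boot all_order all_algebra finmap.
From mathcomp Require Import all_classical all_reals all_analysis.
From mathcomp Require Import measurable_realfun.
From mathcomp Require Import ring lra.

Set Implicit Arguments.
Unset Strict Implicit.
Unset Printing Implicit Defensive.

Import Order.TTheory GRing.Theory Num.Theory.
Import numFieldNormedType.Exports.

Local Open Scope classical_set_scope.
Local Open Scope ring_scope.

(** * Densities of product samples *)

(** What is hard to learn here is a conditional law, not the regression function: [fstar] is one and
    the same function under all the laws, and only the distribution of the covariates in the first
    group depends on the signs. The gap in the support makes the loss linear in the tilt: replacing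
    [delta] by [delta'] moves the jump of the optimum by a level proportional to |delta - delta'|,
    at a squared error of order (c w)^2 on all the levels swept. The loss thus behaves like an L1
    distance between tilts, while the information in the sample is quadratic in them; n^(-1/3) is
    the L1 rate for a Lipschitz function, and tents of height proportional to their width realize
    it. The information sits in the first group, but the loss is measured in the other groups, where
    all the laws have the same density. So the losses for different signs are integrals against one
    reference law, and the two-point bounds of the cells can be added. *)

Section standard_machine.
Local Open Scope ereal_scope.
Context {d : measure_display} {T : measurableType d} {R : realType}.

Import HBNNSimple.

Lemma ge0_measurable_ind (P : (T -> \bar R) -> Prop) :
  (forall A, measurable A -> P (fun x => (\1_A x)%:E)) ->
  (forall f g : T -> \bar R, measurable_fun [set: T] f -> (forall x, 0 <= f x) ->
     measurable_fun [set: T] g -> (forall x, 0 <= g x) ->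
     P f -> P g -> P (fun x => f x + g x)) ->
  (forall (r : R) (f : T -> \bar R), (0 <= r)%R -> measurable_fun [set: T] f ->
     (forall x, 0 <= f x) -> P f -> P (fun x => r%:E * f x)) ->
  (forall g : (T -> \bar R)^nat, (forall n, measurable_fun [set: T] (g n)) ->
     (forall n x, 0 <= g n x) -> (forall x, nondecreasing_seq (g ^~ x)) ->
     (forall n, P (g n)) -> P (fun x => limn (g ^~ x))) ->
  forall f : T -> \bar R, measurable_fun [set: T] f -> (forall x, 0 <= f x) -> P f.
Proof.
move=> P1 PD PZ Plim f mf f0.
pose g := nnsfun_approx measurableT mf.
have -> : f = fun x => limn (fun n => (g n x)%:E).
  by apply/funext => x; apply/esym/cvg_lim => //; exact: cvg_nnsfun_approx.
apply: Plim.
- by move=> n; exact/measurable_EFinP.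
- by move=> n x; rewrite lee_fin.
- by move=> x m n mn; rewrite lee_fin; exact/lefP/nd_nnsfun_approx.
move=> n; move: (g n) => {}g.
have P0 : P (fun=> 0).
  by have := P1 _ measurable0; under eq_fun do rewrite indic0.
have -> : (fun x => (g x)%:E) =
  fun x => \sum_(y <- enum_fset (fset_set (range g))) (y * \1_(g @^-1` [set y]) x)%:E.
  by apply/funext => x; rewrite fimfunE fsbig_finite// sumEFin.
have mg y : measurable (g @^-1` [set y]) by [].
have my y : measurable_fun [set: T] (fun x => (y * \1_(g @^-1` [set y]) x)%:E).
  by apply/measurable_EFinP; exact: measurable_funM.
have y0 y x : 0 <= (y * \1_(g @^-1` [set y]) x)%:E.
  by rewrite EFinM nnfun_muleindic_ge0.
elim: (enum_fset _) => [|y s IH]; first by under eq_fun do rewrite big_nil.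
under eq_fun do rewrite big_cons; apply: PD => //.
- exact: emeasurable_sum.
- by move=> x; exact: sume_ge0.
(* The induction over the list forgets that its entries are values of a nonnegative function; a term
   with [y < 0] is both nonnegative and nonpositive, hence zero. *)
have [yge0|ylt0] := leP 0%R y; last first.
  rewrite (_ : (fun x => _) = fun=> 0)//; apply/funext => x; apply/eqP.
  rewrite eq_le y0 andbT lee_fin; apply: mulr_le0_ge0; [exact: ltW|].
  by rewrite indicE.
under eq_fun do rewrite EFinM; apply: PZ => //; last exact: P1.
exact/measurable_EFinP.
Qed.

End standard_machine.

Section density.
Local Open Scope ereal_scope.
Context {d : measure_display} {T : measurableType d} {R : realType}.

Definition density (P Q : {measure set T -> \bar R}) (p : T -> R) :=
  forall A, measurable A -> P A = \int[Q]_(x in A) (p x)%:E.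

Lemma ge0_integral_density (P Q : {measure set T -> \bar R}) (p : T -> R)
    (f : T -> \bar R) :
  measurable_fun [set: T] p -> (forall x, (0 <= p x)%R) -> density P Q p ->
  measurable_fun [set: T] f -> (forall x, 0 <= f x) ->
  \int[P]_x f x = \int[Q]_x (f x * (p x)%:E).
Proof.
move=> mp p0 PQ; have mp' : measurable_fun [set: T] (EFin \o p).
  exact/measurable_EFinP.
move: f; apply: ge0_measurable_ind.
- move=> A mA; rewrite integral_indic// setIT PQ// integral_mkcond.
  apply: eq_integral => x _; rewrite patchE indicE; case: ifP => _.
    by rewrite mul1e.
  by rewrite mul0e.
- move=> f g mf f0 mg g0 IHf IHg; rewrite ge0_integralD// IHf IHg.
  rewrite -ge0_integralD//.
  + by apply: eq_integral => x _; rewrite ge0_muleDl.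
  + by move=> x _; rewrite mule_ge0// ?lee_fin.
  + exact: emeasurable_funM.
  + by move=> x _; rewrite mule_ge0// ?lee_fin.
  + exact: emeasurable_funM.
- move=> r f r0 mf f0 IH; rewrite ge0_integralZl//.
  rewrite IH -ge0_integralZl//.
  + by apply: eq_integral => x _; rewrite muleA.
  + exact: emeasurable_funM.
  + by move=> x _; rewrite mule_ge0// ?lee_fin.
- move=> g mg g0 ndg IH; rewrite monotone_convergence//.
  under eq_fun do rewrite IH.
  rewrite -monotone_convergence//.
  + apply: eq_integral => x _; apply/cvg_lim => //.
    under eq_fun do rewrite muleC.
    rewrite muleC; apply: cvgeZl => //.
    exact: ereal_nondecreasing_is_cvgn.
  + by move=> n; exact: emeasurable_funM.
  + by move=> n x _; rewrite mule_ge0// ?lee_fin.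
  + by move=> x _ m n mn; rewrite lee_wpmul2r// ?lee_fin//; exact: ndg.
Qed.

End density.

Section iid_density.
Local Open Scope ereal_scope.
Context {d : measure_display} {T : measurableType d} {R : realType}.
Implicit Types P Q : probability T R.

Lemma integral_iid_lawS P n (f : n.+1.-tuple T -> \bar R) :
  measurable_fun [set: n.+1.-tuple T] f -> (forall t, 0 <= f t) ->
  \int[iid_law P n.+1]_t f t =
  \int[P]_z \int[iid_law P n]_t f [tuple of z :: t].
Proof.
move=> mf f0 /=.
rewrite ge0_integral_distribution// fubini_tonelli1//.
- by apply: (measurableT_comp mf); exact: measurable_tcons.
- by move=> u; exact: f0.
Qed.

Lemma integral_iid_law0 P (f : 0.-tuple T -> \bar R) :
  (forall t, 0 <= f t) -> measurable_fun [set: 0.-tuple T] f ->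
  \int[iid_law P 0]_t f t = f [tuple].
Proof.
by move=> f0 mf /=; rewrite integral_dirac// diracT mul1e.
Qed.

Definition likelihood (p : T -> R) n (t : n.-tuple T) : R :=
  (\prod_(i < n) p (tnth t i))%R.

Lemma measurable_likelihood (p : T -> R) n : measurable_fun [set: T] p ->
  measurable_fun [set: n.-tuple T] (likelihood p (n := n)).
Proof.
move=> mp; apply: measurable_prod => i _.
exact: (measurableT_comp mp (measurable_tnth i)).
Qed.

Lemma likelihood_ge0 (p : T -> R) n (t : n.-tuple T) :
  (forall z, 0 <= p z)%R -> (0 <= likelihood p t)%R.
Proof. by move=> p0; apply: prodr_ge0. Qed.

Lemma likelihoodS (p : T -> R) n z (t : n.-tuple T) :
  likelihood p [tuple of z :: t] = (p z * likelihood p t)%R.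
Proof.
rewrite /likelihood big_ord_recl; congr (_ * _)%R.
by apply: eq_bigr => i _; rewrite tnthS.
Qed.

Lemma measurable_cons_tuple n (z : T) :
  measurable_fun [set: n.-tuple T] (fun t => [tuple of z :: t]).
Proof. exact: measurable_cons. Qed.

Lemma iid_law_density P Q (p : T -> R) n (f : n.-tuple T -> \bar R) :
  measurable_fun [set: T] p -> (forall x, (0 <= p x)%R) -> density P Q p ->
  measurable_fun [set: n.-tuple T] f -> (forall t, 0 <= f t) ->
  \int[iid_law P n]_t f t = \int[iid_law Q n]_t (f t * (likelihood p t)%:E).
Proof.
move=> mp p0 PQ.
elim: n f => [|n IH] f mf f0.
  have mL : measurable_fun [set: 0.-tuple T] (fun t => f t * (likelihood p t)%:E).
    by apply: emeasurable_funM => //; apply/measurable_EFinP; exact: measurable_likelihood.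
  rewrite !integral_iid_law0//; first by rewrite /likelihood big_ord0 mule1.
  by move=> t; rewrite mule_ge0// ?lee_fin likelihood_ge0.
have mL : measurable_fun [set: n.+1.-tuple T] (fun t => f t * (likelihood p t)%:E).
  by apply: emeasurable_funM => //; apply/measurable_EFinP; exact: measurable_likelihood.
have L0 t : 0 <= f t * (likelihood p t)%:E.
  by rewrite mule_ge0// ?lee_fin likelihood_ge0.
have mc (g : n.+1.-tuple T -> \bar R) : measurable_fun setT g ->
    measurable_fun [set: T * n.-tuple T] (fun u => g [tuple of u.1 :: u.2]).
  move=> mg; apply: (measurableT_comp mg); exact: measurable_tcons.
have mc1 (g : n.+1.-tuple T -> \bar R) z : measurable_fun setT g ->
    measurable_fun [set: n.-tuple T] (fun t => g [tuple of z :: t]).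
  by move=> mg; exact: (measurableT_comp mg (measurable_cons_tuple _)).
rewrite !integral_iid_lawS//.
under eq_integral => z _ do rewrite (IH _ (mc1 f z mf) (fun t => f0 _)).
rewrite (ge0_integral_density mp p0 PQ); last 2 first.
- pose h (u : T * n.-tuple T) := f [tuple of u.1 :: u.2] * (likelihood p u.2)%:E.
  apply: (@measurable_fun_fubini_tonelli_F _ _ _ _ _ (iid_law Q n) h).
  + apply: emeasurable_funM; first exact: mc.
    apply/measurable_EFinP; apply: measurableT_comp => //.
    exact: measurable_likelihood.
  + by move=> u; rewrite mule_ge0// ?lee_fin likelihood_ge0.
- by move=> z; apply: integral_ge0 => t _; rewrite mule_ge0// ?lee_fin likelihood_ge0.
apply: eq_integral => z _.
rewrite muleC -ge0_integralZl//.
- by apply: eq_integral => t _; rewrite likelihoodS EFinM muleCA.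
- apply: emeasurable_funM; first exact: mc1.
  by apply/measurable_EFinP; exact: measurable_likelihood.
- by move=> t _; rewrite mule_ge0// ?lee_fin likelihood_ge0.
- by rewrite lee_fin.
Qed.

(** Stated for any nonnegative [p], to serve the densities, with integral 1, and also the bound [g]
    on their geometric mean, whose n-fold product integrates to the n-th power of the affinity. *)
Lemma integral_likelihood Q (p : T -> R) n :
  measurable_fun [set: T] p -> (forall x, (0 <= p x)%R) ->
  \int[iid_law Q n]_t (likelihood p t)%:E = (\int[Q]_z (p z)%:E) ^+ n.
Proof.
move=> mp p0; elim: n => [|n IH].
  rewrite integral_iid_law0//; first by rewrite /likelihood big_ord0 expe0.
  - by move=> t; rewrite lee_fin likelihood_ge0.
  - by apply/measurable_EFinP; exact: measurable_likelihood.
rewrite integral_iid_lawS//; last 2 first.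
- by apply/measurable_EFinP; exact: measurable_likelihood.
- by move=> t; rewrite lee_fin likelihood_ge0.
have mL : measurable_fun [set: n.-tuple T] (EFin \o likelihood p (n := n)).
  by apply/measurable_EFinP; exact: measurable_likelihood.
under eq_integral => z _.
  under eq_integral do rewrite likelihoodS EFinM.
  rewrite ge0_integralZl//; last 2 first.
  - by move=> t _; rewrite lee_fin likelihood_ge0.
  - by rewrite lee_fin.
  rewrite IH; over.
rewrite expeS ge0_integralZr//; first exact/measurable_EFinP.
- by move=> z _; rewrite lee_fin.
- by apply: expe_ge0; apply: integral_ge0 => z _; rewrite lee_fin.
Qed.

End iid_density.

Section two_point.
Context {d : measure_display} {T : measurableType d} {R : realType}.

Lemma bernoulli_ineq (x : R) n : 0 <= x <= 1 -> 1 - n%:R * x <= (1 - x) ^+ n.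
Proof.
move=> /andP[x0 x1]; elim: n => [|n IH]; first by rewrite mul0r subr0 expr0.
rewrite exprS -natr1; have n0 : 0 <= n%:R :> R by [].
have := ler_wpM2l (_ : 0 <= 1 - x) IH; rewrite subr_ge0 => /(_ x1); nra.
Qed.

(* AM-GM with weights balanced so that integrating likelihoods loses only [1 / 2]. *)
Lemma geometric_le_min (a b g : R) : 0 <= a -> 0 <= b -> 0 <= g ->
  g ^+ 2 <= a * b -> g <= Num.min a b + (a + b) / 4.
Proof.
move=> a0 b0 g0 gab; have [ab|ba] := leP a b.
  apply: (@le_trans _ _ (a + b / 4)); last lra.
  rewrite -(@ler_pXn2r _ 2) ?nnegrE//; last lra.
  by rewrite (le_trans gab)//; have := sqr_ge0 (a - b / 4); nra.
apply: (@le_trans _ _ (b + a / 4)); last lra.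
rewrite -(@ler_pXn2r _ 2) ?nnegrE//; last lra.
by rewrite (le_trans gab)//; have := sqr_ge0 (b - a / 4); nra.
Qed.

(** Le Cam's two-point argument: whatever the sample, the two losses add up to [D], so the two risks
    add up to at least [D] times the mass common to the two product laws. A function [g] below the
    geometric mean of [p] and [q], with integral close to 1, replaces the Hellinger affinity and
    avoids square roots. *)
Lemma two_point_bound (Q : probability T R) (p q g : T -> R) n
    (l1 l2 : n.-tuple T -> \bar R) (x D : R) :
  measurable_fun [set: T] p -> measurable_fun [set: T] q ->
  measurable_fun [set: T] g ->
  (forall z, 0 <= p z) -> (forall z, 0 <= q z) -> (forall z, 0 <= g z) ->
  (forall z, g z ^+ 2 <= p z * q z) ->
  (\int[Q]_z (p z)%:E = 1)%E -> (\int[Q]_z (q z)%:E = 1)%E ->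
  ((1 - x)%:E <= \int[Q]_z (g z)%:E)%E ->
  0 <= x <= 1 -> n%:R * x <= 4^-1 -> 0 <= D ->
  measurable_fun [set: n.-tuple T] l1 -> measurable_fun [set: n.-tuple T] l2 ->
  (forall t, 0 <= l1 t)%E -> (forall t, 0 <= l2 t)%E ->
  (forall t, D%:E <= l1 t + l2 t)%E ->
  ((D / 4)%:E <= \int[iid_law Q n]_t (l1 t * (likelihood p t)%:E) +
                 \int[iid_law Q n]_t (l2 t * (likelihood q t)%:E))%E.
Proof.
move=> mp mq mg p0 q0 g0 gpq p1 q1 g1 x01 nx D0 ml1 ml2 l10 l20 lD.
pose Lp := likelihood p (n := n); pose Lq := likelihood q (n := n).
pose G := likelihood g (n := n); pose m t := Num.min (Lp t) (Lq t).
have mLp : measurable_fun setT Lp by exact: measurable_likelihood.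
have mLq : measurable_fun setT Lq by exact: measurable_likelihood.
have mG : measurable_fun setT G by exact: measurable_likelihood.
have mm : measurable_fun setT m by exact: measurable_minr.
have Lp0 t : 0 <= Lp t by exact: likelihood_ge0.
have Lq0 t : 0 <= Lq t by exact: likelihood_ge0.
have G0 t : 0 <= G t by exact: likelihood_ge0.
have m0 t : 0 <= m t by rewrite /m le_min Lp0 Lq0.
have GLL t : G t <= m t + (Lp t + Lq t) / 4.
  apply: geometric_le_min => //.
  rewrite /G /Lp /Lq /likelihood -prodrXl -big_split/=.
  by apply: ler_prod => i _; rewrite sqr_ge0/=.
(* Integrate [GLL]: the left side gives at least (1 - x)^n >= 1 - n x >= 3/4, and the two
   likelihoods contribute 1/2 on the right, which leaves 1/4 for the minimum. *)
have intm : (4^-1%:E <= \int[iid_law Q n]_t (m t)%:E)%E.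
  have intG : ((3 / 4)%:E <= \int[iid_law Q n]_t (G t)%:E)%E.
    rewrite integral_likelihood//.
    apply: (@le_trans _ _ ((1 - x)%:E ^+ n)%E); last first.
      have x1 : (0 <= (1 - x)%:E)%E by rewrite lee_fin subr_ge0; case/andP: x01.
      elim: (n) => [|i IH]; first by rewrite !expe0.
      by rewrite !expeS lee_pmul// expe_ge0.
    rewrite -EFin_expe lee_fin (le_trans _ (bernoulli_ineq n x01))//; lra.
  have : (\int[iid_law Q n]_t (G t)%:E <=
          \int[iid_law Q n]_t ((m t)%:E + 4^-1%:E * ((Lp t)%:E + (Lq t)%:E)))%E.
    apply: ge0_le_integral => //.
    - by move=> t _; rewrite lee_fin.
    - exact/measurable_EFinP.
    - apply/measurable_EFinP; apply: measurable_funD => //.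
      by apply: measurable_funM => //; exact: measurable_funD.
    - by move=> t _; rewrite muleC; exact: GLL.
  rewrite ge0_integralD//; last 4 first.
  - by move=> t _; rewrite lee_fin.
  - exact/measurable_EFinP.
  - by move=> t _; rewrite mule_ge0// lee_fin addr_ge0.
  - apply/measurable_EFinP; apply: measurable_funM => //.
    exact: measurable_funD.
  rewrite ge0_integralZl//; last 2 first.
  - by apply/measurable_EFinP; exact: measurable_funD.
  - by move=> t _; rewrite lee_fin addr_ge0.
  rewrite ge0_integralD//; last 4 first.
  - by move=> t _; rewrite lee_fin.
  - exact/measurable_EFinP.
  - by move=> t _; rewrite lee_fin.
  - exact/measurable_EFinP.
  have -> : (\int[iid_law Q n]_t (Lp t)%:E = 1)%E.
    by rewrite integral_likelihood// p1 -EFin_expe expr1n.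
  have -> : (\int[iid_law Q n]_t (Lq t)%:E = 1)%E.
    by rewrite integral_likelihood// q1 -EFin_expe expr1n.
  move=> /(le_trans intG).
  case: (\int[_]_t (m t)%:E)%E => [r| |]//.
  - by rewrite -(EFinD 1 1) -EFinM -EFinD !lee_fin; lra.
  - by move=> _; rewrite leey.
rewrite -ge0_integralD//; last 4 first.
- by move=> t _; rewrite mule_ge0// lee_fin.
- by apply: emeasurable_funM => //; exact/measurable_EFinP.
- by move=> t _; rewrite mule_ge0// lee_fin.
- by apply: emeasurable_funM => //; exact/measurable_EFinP.
apply: (@le_trans _ _ (\int[iid_law Q n]_t (D%:E * (m t)%:E))%E).
  rewrite ge0_integralZl//; last 2 first.
  - exact/measurable_EFinP.
  - by move=> t _; rewrite lee_fin.
  by rewrite EFinM lee_wpmul2l// lee_fin.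
apply: ge0_le_integral => //.
- by move=> t _; rewrite lee_fin mulr_ge0.
- by apply/measurable_EFinP; exact: measurable_funM.
- by apply: emeasurable_funD; apply: emeasurable_funM => //; exact/measurable_EFinP.
- move=> t _; apply: (@le_trans _ _ ((l1 t + l2 t) * (m t)%:E)%E).
    by rewrite lee_wpmul2r// lee_fin.
  rewrite ge0_muleDl//; apply: leeD; apply: lee_wpmul2l => //.
  + by rewrite lee_fin ge_min lexx.
  + by rewrite lee_fin ge_min lexx orbT.
Qed.

End two_point.

(** * The fair barycenter and its dual certificate *)

Section barycenter.
Context {R : realType}.
Implicit Types (c w d r u y t : R).

(* Given [V = v] with [delta v = d], the law of [fstar] in the first group is the image under
   [lumps] of the density [1 - d] on [0, 1/2] and [1 + d] on [1/2, 1]: [tilt_cdf d] is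
   the c.d.f. of this density, [tilt_quantile d] its inverse. *)
Definition tilt_cdf d u : R := if u < 2^-1 then (1 - d) * u else (1 + d) * u - d.

Definition tilt_quantile d r : R :=
  if r < (1 - d) / 2 then r / (1 - d) else (r + d) / (1 + d).

Definition tilt_density d u : R := if u < 2^-1 then 1 - d else 1 + d.

Definition lumps c u : R := c * (if u < 2^-1 then u else u + 1).

(** All the untilted groups share the quantile function [c * r], so that only the weight [w] of the
    first group matters. *)
Definition bary_quantile c w d r : R :=
  w * lumps c (tilt_quantile d r) + (1 - w) * (c * r).

Lemma tilt_quantile_lt d r : -2^-1 <= d <= 2^-1 ->
  (tilt_quantile d r < 2^-1) = (r < (1 - d) / 2).
Proof.
move=> /andP[d1 d2]; rewrite /tilt_quantile; case: (ltP r) => h.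
  by rewrite ltr_pdivrMr; lra.
by apply/negbTE; rewrite -leNgt ler_pdivlMr; lra.
Qed.

Lemma tilt_quantileK d : -2^-1 <= d <= 2^-1 ->
  cancel (tilt_quantile d) (tilt_cdf d).
Proof.
move=> dd r; rewrite /tilt_cdf tilt_quantile_lt// /tilt_quantile.
by case: ltP => h; field; lra.
Qed.

Lemma tilt_quantile01 d r : -2^-1 <= d <= 2^-1 -> 0 <= r <= 1 ->
  0 <= tilt_quantile d r <= 1.
Proof.
move=> /andP[d1 d2] /andP[r0 r1]; rewrite /tilt_quantile; case: ltP => h.
  by rewrite divr_ge0 ?ler_pdivrMr; lra.
by rewrite divr_ge0 ?ler_pdivrMr; lra.
Qed.

Lemma lumps_bounds c u : 0 <= c -> 0 <= u <= 1 -> 0 <= lumps c u <= 2 * c.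
Proof. by move=> c0 /andP[u0 u1]; rewrite /lumps; case: ltP => h; nra. Qed.

Lemma lumps_inj c : 0 < c -> injective (lumps c).
Proof.
move=> c0 u v; rewrite /lumps => /(mulfI (lt0r_neq0 c0)).
by do 2 case: ltP => ?; lra.
Qed.

Lemma bary_quantile_bounds c w d r : 0 <= c -> 0 <= w <= 1 ->
  -2^-1 <= d <= 2^-1 -> 0 <= r <= 1 -> 0 <= bary_quantile c w d r <= 2 * c.
Proof.
move=> c0 /andP[w_ge0 w_le1] dd r01; rewrite /bary_quantile.
have /andP[l0 l1] := lumps_bounds c0 (tilt_quantile01 dd r01).
case/andP: r01 => r0 r1; apply/andP; split.
  by rewrite addr_ge0// mulr_ge0//; [lra|nra].
have : w * lumps c (tilt_quantile d r) <= w * (2 * c) by exact: ler_wpM2l.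
have : (1 - w) * (c * r) <= (1 - w) * (2 * c) by apply: ler_wpM2l; [lra|nra].
by lra.
Qed.

(* Slopes of the inverse of [bary_quantile] (up to the factor [c]) on both sides of
   its jump, which goes from [jump_lo c w d] to [jump_lo c w d + c * w]. *)
Definition slope_lo w d := (w / (1 - d) + (1 - w))^-1.
Definition slope_hi w d := (w / (1 + d) + (1 - w))^-1.
Definition jump_lo c w d := c * (w / 2 + (1 - w) * ((1 - d) / 2)).

(* The Brenier potential from the barycenter to the law of the untilted groups. *)
Definition brenier c w d y : R :=
  slope_lo w d / 2 * Num.min (y - jump_lo c w d) 0 ^+ 2 +
  slope_hi w d / 2 * Num.max (y - (jump_lo c w d + c * w)) 0 ^+ 2 + c * ((1 - d) / 2) * y.

(** The untilted groups alone give [bary_quantile] a slope of at least [c * (1 - w)]. The resulting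
    bound on the slopes of its inverse is the smoothness of the Brenier potential on which the
    certificate of the first group rests. *)
Lemma slope_lo_bnd w d (w_gt0 : 0 < w) (w_lt1 : w < 1)
    (d_bnd : -2^-1 <= d <= 2^-1) : 0 <= slope_lo w d <= (1 - w)^-1.
Proof.
have dp : 0 < 1 - d by case/andP: d_bnd; lra.
have wd : 0 < w / (1 - d) by rewrite divr_gt0.
by rewrite /slope_lo invr_ge0 lef_pV2 ?posrE; set x := w / _ in wd *; lra.
Qed.

Lemma slope_hi_bnd w d (w_gt0 : 0 < w) (w_lt1 : w < 1)
    (d_bnd : -2^-1 <= d <= 2^-1) : 0 <= slope_hi w d <= (1 - w)^-1.
Proof.
have dp : 0 < 1 + d by case/andP: d_bnd; lra.
have wd : 0 < w / (1 + d) by rewrite divr_gt0.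
by rewrite /slope_hi invr_ge0 lef_pV2 ?posrE; set x := w / _ in wd *; lra.
Qed.

(** Together with [bary_quantile_hi]: the derivative of [brenier] at the barycenter point of level
    [r] is [c * r], the value of the untilted groups at that level. *)
Lemma bary_quantile_lo c w d r (c_gt0 : 0 < c) (w_gt0 : 0 < w) (w_lt1 : w < 1)
    (d_bnd : -2^-1 <= d <= 2^-1) :
  r < (1 - d) / 2 ->
  bary_quantile c w d r - jump_lo c w d < 0 /\
  slope_lo w d * (bary_quantile c w d r - jump_lo c w d) = c * (r - (1 - d) / 2).
Proof.
move=> h; have dp : 0 < 1 - d by case/andP: d_bnd; lra.
have wd : 0 < w / (1 - d) by rewrite divr_gt0.
have s0 : 0 < w / (1 - d) + (1 - w) by rewrite addr_gt0// subr_gt0.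
have E : bary_quantile c w d r - jump_lo c w d =
    (w / (1 - d) + (1 - w)) * (c * (r - (1 - d) / 2)).
  rewrite /bary_quantile /lumps tilt_quantile_lt// /tilt_quantile h /jump_lo.
  by field; lra.
rewrite E /slope_lo mulKf ?gt_eqF//; split=> //.
by rewrite pmulr_rlt0// pmulr_rlt0// subr_lt0.
Qed.

Lemma bary_quantile_hi c w d r (c_gt0 : 0 < c) (w_gt0 : 0 < w) (w_lt1 : w < 1)
    (d_bnd : -2^-1 <= d <= 2^-1) :
  (1 - d) / 2 <= r ->
  0 <= bary_quantile c w d r - (jump_lo c w d + c * w) /\
  slope_hi w d * (bary_quantile c w d r - (jump_lo c w d + c * w)) =
    c * (r - (1 - d) / 2).
Proof.
move=> h; have dp : 0 < 1 + d by case/andP: d_bnd; lra.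
have wd : 0 < w / (1 + d) by rewrite divr_gt0.
have s0 : 0 < w / (1 + d) + (1 - w) by rewrite addr_gt0// subr_gt0.
have E : bary_quantile c w d r - (jump_lo c w d + c * w) =
    (w / (1 + d) + (1 - w)) * (c * (r - (1 - d) / 2)).
  rewrite /bary_quantile /lumps tilt_quantile_lt// /tilt_quantile.
  by rewrite ltNge h /= /jump_lo; field; lra.
rewrite E /slope_hi mulKf ?gt_eqF//; split=> //.
by rewrite pmulr_rge0// pmulr_rge0// subr_ge0.
Qed.

(* The Bregman divergences of the two hinges are nonnegative, and their sum is at most
   that of [y ^+ 2 / 2]. *)
Lemma hinge_divergence (a a' b g y y0 : R) :
  0 <= g -> 0 <= a <= b -> 0 <= a' <= b ->
  0 <= a / 2 * Num.min y 0 ^+ 2 + a' / 2 * Num.max (y - g) 0 ^+ 2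
     - a / 2 * Num.min y0 0 ^+ 2 - a' / 2 * Num.max (y0 - g) 0 ^+ 2
     - (a * Num.min y0 0 + a' * Num.max (y0 - g) 0) * (y - y0)
     <= b / 2 * (y - y0) ^+ 2.
Proof.
move=> g0 /andP[a0 ab] /andP[a'0 a'b].
pose D1 := Num.min y 0 ^+ 2 - Num.min y0 0 ^+ 2 - 2 * Num.min y0 0 * (y - y0).
pose D2 := Num.max (y - g) 0 ^+ 2 - Num.max (y0 - g) 0 ^+ 2
  - 2 * Num.max (y0 - g) 0 * (y - y0).
have [D10 [D20 D12]] : 0 <= D1 /\ (0 <= D2 /\ D1 + D2 <= (y - y0) ^+ 2).
  have s0 := sqr_ge0 (y - y0).
  rewrite /D1 /D2; case: (leP y 0) => h1; case: (leP y0 0) => h2;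
  case: (leP (y - g) 0) => h3; case: (leP (y0 - g) 0) => h4; split; try split; nra.
set X := (X in 0 <= X).
have -> : X = (a * D1 + a' * D2) / 2 by rewrite /X /D1 /D2; field.
apply/andP; split; first by rewrite divr_ge0// addr_ge0// mulr_ge0.
have : a * D1 <= b * D1 by exact: ler_wpM2r.
have : a' * D2 <= b * D2 by exact: ler_wpM2r.
have : b * (D1 + D2) <= b * (y - y0) ^+ 2 by apply: ler_wpM2l => //; lra.
by rewrite /D1 /D2; lra.
Qed.

(** Since [c * r] is the derivative of [brenier] at [y0], the middle term is a Bregman divergence:
    the lower bound is convexity, the upper bound is the Lipschitz constant (1 - w)^-1 of the
    derivative. *)
Lemma brenier_divergence c w d r y y0 (c_gt0 : 0 < c) (w_gt0 : 0 < w) (w_lt1 : w < 1)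
    (d_bnd : -2^-1 <= d <= 2^-1) :
  y0 = bary_quantile c w d r ->
  0 <= brenier c w d y - brenier c w d y0 - c * r * (y - y0)
    <= (1 - w)^-1 / 2 * (y - y0) ^+ 2.
Proof.
move=> y0E.
have cw : 0 <= c * w by rewrite mulr_ge0// ltW.
have := hinge_divergence (y - jump_lo c w d) (y0 - jump_lo c w d) cw
  (slope_lo_bnd w_gt0 w_lt1 d_bnd) (slope_hi_bnd w_gt0 w_lt1 d_bnd).
rewrite (_ : y - jump_lo c w d - (y0 - jump_lo c w d) = y - y0); last by ring.
have sub2 z : z - jump_lo c w d - c * w = z - (jump_lo c w d + c * w) by ring.
rewrite !sub2 /brenier.
suff -> : slope_lo w d * Num.min (y0 - jump_lo c w d) 0 +
    slope_hi w d * Num.max (y0 - (jump_lo c w d + c * w)) 0 = c * r - c * ((1 - d) / 2).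
  by set u := Num.min _ _; set v := Num.max _ _; set u' := Num.min _ _;
    set v' := Num.max _ _; lra.
case: (ltP r ((1 - d) / 2)) => h.
  have [n0 E] := bary_quantile_lo c_gt0 w_gt0 w_lt1 d_bnd h; rewrite -y0E in n0 E.
  have h1 : y0 - (jump_lo c w d + c * w) <= 0 by lra.
  rewrite (min_idPl (ltW n0)) (max_idPr h1) E; lra.
have [n0 E] := bary_quantile_hi c_gt0 w_gt0 w_lt1 d_bnd h; rewrite -y0E in n0 E.
have h1 : 0 <= y0 - jump_lo c w d by lra.
by rewrite (min_idPr h1) (max_idPl n0) E; lra.
Qed.

(** Two requirements fix the coefficients: in an untilted group the squares cancel in
    [(y - t) ^+ 2 - potential], leaving a convex function of [y], and the weighted sum over the
    groups vanishes, which dictates the multiple used in the first group. *)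
Definition potential c w d (first : bool) y : R :=
  if first then - ((1 - w) / w) * (y ^+ 2 - 2 * brenier c w d y)
  else y ^+ 2 - 2 * brenier c w d y.

Lemma potential_sum c w d y (w_gt0 : 0 < w) :
  w * potential c w d true y + (1 - w) * potential c w d false y = 0.
Proof. by rewrite /potential; field; rewrite gt_eqF. Qed.

(** That is, [y0] minimizes [(y - t) ^+ 2 - potential]. In an untilted group this is t^2 - 2 t y + 2
    brenier(y), convex, and stationary where the derivative of [brenier] is t = c r. In the first
    group, after multiplication by [w] and up to a constant, it is y^2 - 2 w t y - 2 (1 - w)
    brenier(y): stationary at y0 = w t + (1 - w) c r, and convex because (1 - w) brenier has a
    1-Lipschitz derivative. *)
Lemma potential_certificate c w d first r y t y0 (c_gt0 : 0 < c) (w_gt0 : 0 < w) (w_lt1 : w < 1)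
    (d_bnd : -2^-1 <= d <= 2^-1) :
  t = (if first then lumps c (tilt_quantile d r) else c * r) ->
  y0 = bary_quantile c w d r ->
  (y0 - t) ^+ 2 + potential c w d first y <= (y - t) ^+ 2 + potential c w d first y0.
Proof.
move=> tE y0E; have /andP[D0 D1] := brenier_divergence y c_gt0 w_gt0 w_lt1 d_bnd y0E.
rewrite /potential; case: first tE => tE; last by rewrite tE; nra.
have w1 : 0 < 1 - w by lra.
have E : w * t = y0 - (1 - w) * (c * r) by rewrite y0E /bary_quantile tE; ring.
have D1' : (1 - w) * (brenier c w d y - brenier c w d y0 - c * r * (y - y0)) <= (y - y0) ^+ 2 / 2.
  move: D1; rewrite -(ler_pM2l w1) => /le_trans; apply.
  by rewrite !mulrA mulfV ?gt_eqF//; lra.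
rewrite -subr_ge0 -(pmulr_rge0 _ w_gt0).
set X := (X in 0 <= X).
have -> : X = (y ^+ 2 - y0 ^+ 2) - 2 * (w * t) * (y - y0)
    - 2 * ((1 - w) * (brenier c w d y - brenier c w d y0)).
  by rewrite /X; field; rewrite gt_eqF.
by rewrite E; nra.
Qed.

End barycenter.

(** * The statistical model *)

Section pair_encoding.
Context {R : realType}.

(** In base 4 with digits 0 and 1 the tail after the leading digit is at most 1/3, so that
    expansions are unique and the leading bit is read off by a comparison with 1. *)
Definition bitsum (b : nat -> bool) (n : nat) : R :=
  \sum_(0 <= i < n) (b i)%:R * 4^-1 ^+ i.

Definition bitcode (b : nat -> bool) : R := limn (bitsum b).

Lemma bitsum_recl b n :
  bitsum b n.+1 = (b 0)%:R + 4^-1 * bitsum (b \o S) n.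
Proof.
rewrite /bitsum big_nat_recl// expr0 mulr1; congr (_ + _).
by rewrite mulr_sumr; apply: eq_bigr => i _; rewrite exprS mulrCA.
Qed.

Lemma bitsum_bounds b n : 0 <= bitsum b n <= 4 / 3.
Proof.
elim: n b => [|n IH] b; first by rewrite /bitsum big_nil; apply/andP; split; lra.
rewrite bitsum_recl; have /andP[b0 b1] := IH (b \o S).
by case: (b 0%N) => /=; lra.
Qed.

Lemma cvg_bitsum b : bitsum b @ \oo --> bitcode b.
Proof.
apply: nondecreasing_is_cvgn.
  apply/nondecreasing_seqP => n; rewrite /bitsum big_nat_recr//= lerDl.
  by rewrite mulr_ge0// exprn_ge0// invr_ge0.
by exists (4 / 3) => _ [n _ <-]; have /andP[] := bitsum_bounds b n.
Qed.

Lemma bitcode_bounds b : 0 <= bitcode b <= 4 / 3.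
Proof.
have cb : cvgn (bitsum b) by apply/cvg_ex; exists (bitcode b); exact: cvg_bitsum.
apply/andP; split; [apply: limr_ge => //|apply: limr_le => //];
  by apply: nearW => n; have /andP[] := bitsum_bounds b n.
Qed.

Lemma bitcode_recl b : bitcode b = (b 0)%:R + 4^-1 * bitcode (b \o S).
Proof.
have h1 : (fun n => bitsum b n.+1) @ \oo --> bitcode b.
  by rewrite (cvg_shiftS (bitsum b)); exact: cvg_bitsum.
have h2 : (fun n => bitsum b n.+1) @ \oo --> (b 0)%:R + 4^-1 * bitcode (b \o S).
  under eq_fun do rewrite bitsum_recl.
  by apply: cvgD; [exact: cvg_cst|apply: cvgMr; exact: cvg_bitsum].
by rewrite -(cvg_lim (@Rhausdorff R) h1); exact: cvg_lim.
Qed.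

Definition bitshift (x : R) : R := 4 * (x - (1 <= x)%R%:R).

Lemma bitcode_ge1 b : (1 <= bitcode b) = b 0.
Proof.
rewrite bitcode_recl; have /andP[c0 c1] := bitcode_bounds (b \o S).
case: (b 0%N) => /=; first by apply/idP; lra.
by apply/negbTE; rewrite -ltNge; lra.
Qed.

Lemma bitshift_code b : bitshift (bitcode b) = bitcode (b \o S).
Proof. by rewrite /bitshift bitcode_ge1 [in LHS]bitcode_recl; field. Qed.

Definition digit (n : nat) (x : R) : bool := 1 <= iter n bitshift x.

Lemma digit_code b n : digit n (bitcode b) = b n.
Proof.
rewrite /digit (_ : iter n _ _ = bitcode (fun i => b (n + i)%N)).
  by rewrite bitcode_ge1 addn0.
elim: n => [//|n IH]; rewrite iterS IH bitshift_code.
by congr bitcode; apply/funext => i /=; rewrite addnS.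
Qed.

Lemma measurable_bitshift : measurable_fun [set: R] bitshift.
Proof.
apply: measurable_funM => //; apply: measurable_funB => //.
rewrite (_ : (fun x => _) = fun x : R => if (1 <= x)%R then 1 else 0); last first.
  by apply/funext => x; case: (1 <= x).
by apply: measurable_fun_ifT => //; exact: measurable_fun_ler.
Qed.

Lemma measurable_digit n : measurable_fun [set: R] (digit n).
Proof.
apply: measurable_fun_ler => //; elim: n => [|n IH]; first exact: measurable_id.
exact: (measurableT_comp measurable_bitshift IH).
Qed.

Lemma measurable_bitcode d (T : measurableType d) (b : T -> nat -> bool) :
  (forall n, measurable_fun [set: T] (b ^~ n)) ->
  measurable_fun [set: T] (fun x => bitcode (b x)).
Proof.
move=> mb; apply: (measurable_fun_cvg (h := fun n x => bitsum (b x) n)).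
  move=> n; apply: measurable_sum => i; apply: measurable_funM => //.
  rewrite (_ : (fun x => _) = fun x => if b x i then 1 else 0); last first.
    by apply/funext => x; case: (b x i).
  exact: measurable_fun_ifT.
by move=> x _; exact: cvg_bitsum.
Qed.

(** Every rational occurs; an index that decodes to nothing gives 0, a harmless repetition in a
    supremum. *)
Definition ratseq (n : nat) : R := ratr (odflt 0 (choice.unpickle n)).

(* Decodes a real from its left Dedekind cut. *)
Definition cut_sup (b : nat -> bool) : R :=
  fine (esups (fun n => if b n then (ratseq n)%:E else -oo%E) 0).

Lemma cut_sup_lt (v : R) : cut_sup (fun n => ratseq n < v) = v.
Proof.
rewrite /cut_sup (_ : esups _ _ = v%:E)//.
rewrite /esups /=; apply/eqP; rewrite eq_le; apply/andP; split.
  apply: ge_ereal_sup => _ [n _ <-]; case: ifP => h; last by rewrite leNye.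
  by rewrite lee_fin ltW.
apply/lee_subgt0Pr => e e0.
have /rat_in_itvoo[q] : v - e < v by lra.
rewrite in_itv/= => /andP[q1 q2].
apply: (@le_trans _ _ (ratr q)%:E); first by rewrite -EFinB lee_fin ltW.
apply: ereal_sup_ubound; exists (choice.pickle q) => //=.
by rewrite /ratseq choice.pickleK /= q2.
Qed.

Lemma measurable_cut_sup d (T : measurableType d) (b : T -> nat -> bool) :
  (forall n, measurable_fun [set: T] (b ^~ n)) ->
  measurable_fun [set: T] (fun x => cut_sup (b x)).
Proof.
move=> mb; apply: (measurableT_comp (fine_measurable measurableT)).
apply: (measurable_fun_esups (f := fun n x => if b x n then (ratseq n)%:E else -oo%E)).
by move=> n; exact: measurable_fun_ifT.
Qed.

(** Interleaves the bits of the left Dedekind cuts of the two reals. Cuts, unlike binary digits, are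
    unambiguous for every real, so the decoding is exact everywhere and not just almost
    everywhere. *)
Definition encode (vu : R * R) : R :=
  bitcode (fun n => ratseq n./2 < if odd n then vu.2 else vu.1).

Definition decode1 (x : R) : R := cut_sup (fun n => digit n.*2 x).
Definition decode2 (x : R) : R := cut_sup (fun n => digit n.*2.+1 x).

Lemma encodeK1 vu : decode1 (encode vu) = vu.1.
Proof.
rewrite /decode1 -[RHS]cut_sup_lt; congr cut_sup; apply/funext => n.
by rewrite digit_code odd_double doubleK.
Qed.

Lemma encodeK2 vu : decode2 (encode vu) = vu.2.
Proof.
rewrite /decode2 -[RHS]cut_sup_lt; congr cut_sup; apply/funext => n.
by rewrite digit_code /= odd_double uphalf_double.
Qed.

Lemma measurable_encode : measurable_fun [set: R * R] encode.
Proof.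
apply: measurable_bitcode => n; apply: measurable_fun_ltr => //.
by case: (odd n); [exact: measurable_snd|exact: measurable_fst].
Qed.

Lemma measurable_decode1 : measurable_fun [set: R] decode1.
Proof. by apply: measurable_cut_sup => n; exact: measurable_digit. Qed.

Lemma measurable_decode2 : measurable_fun [set: R] decode2.
Proof. by apply: measurable_cut_sup => n; exact: measurable_digit. Qed.

End pair_encoding.

Section unif01.
Context {R : realType}.
Local Open Scope ereal_scope.

Let idR (x : measurableTypeR R) : R := x.

Let measurable_idR : measurable_fun setT idR.
Proof. exact: measurable_id. Qed.

HB.instance Definition _ := isMeasurableFun.Build _ _ _ _ idR measurable_idR.

(* [uniform_prob] lives on [measurableTypeR R], whose canonical structures differ
   from those of [R]. *)
Let exists_unif01 :
  {P : probability R R | P = distribution (uniform_prob (@ltr01 R)) idR}.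
Proof. by exists (distribution (uniform_prob (@ltr01 R)) idR). Qed.

Definition unif01 : probability R R := sval exists_unif01.

Lemma unif01E (A : set R) : unif01 A = uniform_prob (@ltr01 R) A.
Proof. by rewrite /unif01 (svalP exists_unif01). Qed.

Lemma integral_unif01 (f : R -> \bar R) :
  measurable_fun [set: R] f -> (forall x, 0 <= f x) ->
  \int[unif01]_x f x = \int[@lebesgue_measure R]_(x in `[0%R, 1%R]) f x.
Proof.
move=> mf f0; rewrite /unif01 (svalP exists_unif01) ge0_integral_distribution//.
by rewrite integral_uniform// subr0 invr1 mul1e.
Qed.

End unif01.

(** * Change of variables for the uniform law *)

Section uniform_change_of_variables.
Context {R : realType}.
Local Notation leb := (@lebesgue_measure R).
Local Notation unif := (@unif01 R).
Local Open Scope ereal_scope.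

Lemma unif01_lebesgue (A : set R) : measurable A -> unif A = leb (A `&` `[0%R, 1%R]).
Proof.
move=> mA; rewrite -[in LHS](setIT A) -integral_indic// integral_unif01//.
  by rewrite integral_indic.
by apply/measurable_EFinP; exact: measurable_indic.
Qed.

(** By uniqueness of Lebesgue measure, it is enough to compare the two sides on half-open
    intervals. *)
Lemma lebesgue_measure_affine (a b : R) (B : set R) : (0 < a)%R -> measurable B ->
  leb B = a%:E * leb ((fun x => a * x + b)%R @^-1` B).
Proof.
move=> a0 mB.
have mf : measurable_fun [set: measurableTypeR R]
    ((fun x => a * x + b)%R : measurableTypeR R -> measurableTypeR R).
  by apply: measurable_funD => //; exact: measurable_funM.
pose m := mscale (NngNum (ltW a0)) (pushforward leb
  ((fun x => a * x + b)%R : measurableTypeR R -> measurableTypeR R)).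
rewrite (@lebesgue_measure_unique R (m mf))// => _ [[p q] _ <-] /=.
rewrite /m /= /mscale /= /pushforward.
rewrite (_ : _ @^-1` _ = [set` `](p - b) / a, (q - b) / a]%R]); last first.
  apply/seteqP; split => x /=; rewrite !in_itv/=.
    by move=> /andP[h1 h2]; rewrite ltr_pdivrMr// ler_pdivlMr//; lra.
  by rewrite ltr_pdivrMr// ler_pdivlMr// => /andP[h1 h2]; lra.
rewrite !lebesgue_measure_itv/= !lte_fin ltr_pM2r ?invr_gt0// ltrD2r.
case: ifP => h; last by rewrite mule0.
by rewrite -EFinB -EFinM; congr (_%:E); field; rewrite gt_eqF.
Qed.

Lemma unit_itv_halves (B : set R) :
  B `&` `[0%R, 1%R] = (B `&` `[0%R, 2^-1%R[) `|` (B `&` `[2^-1%R, 1%R]).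
Proof.
rewrite -setIUr; congr (_ `&` _); apply/seteqP; split => x /=; rewrite !in_itv/=.
  by case: (ltP x 2^-1%R) => h /andP[h1 h2]; [left|right]; lra.
by case=> /andP[h1 h2]; lra.
Qed.

Lemma unit_halves_disjoint (B : set R) :
  [disjoint B `&` `[0%R, 2^-1%R[ & B `&` `[2^-1%R, 1%R]].
Proof.
apply/disj_setPS => x [[_ /=]]; rewrite in_itv/= => /andP[_ h1] [_ /=].
by rewrite in_itv/= => /andP[h2 _]; move: (lt_le_trans h1 h2); rewrite ltxx.
Qed.

(** On each side of the level (1 - d)/2 the quantile function is affine, with slopes 1/(1 - d) and
    1/(1 + d), and the two pieces map onto the two halves of [0, 1]. *)
Lemma tilt_quantile_law (d : R) (B : set R) :
  (-2^-1 <= d <= 2^-1)%R -> measurable B ->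
  unif (tilt_quantile d @^-1` B) =
    (1 - d)%:E * leb (B `&` `[0%R, 2^-1%R[) + (1 + d)%:E * leb (B `&` `[2^-1%R, 1%R]).
Proof.
move=> dd mB; have [d1 d2] := andP dd.
have mq : measurable_fun [set: R] (tilt_quantile d).
  apply: measurable_fun_ifT; first exact: measurable_fun_ltr.
    exact: measurable_funM.
  by apply: measurable_funM => //; exact: measurable_funD.
have mqB : measurable (tilt_quantile d @^-1` B).
  by rewrite -[X in measurable X]setTI; exact: mq.
pose A1 := B `&` `[0%R, 2^-1%R[; pose A2 := B `&` `[2^-1%R, 1%R].
have mA1 : measurable A1 by exact: measurableI.
have mA2 : measurable A2 by exact: measurableI.
have maff (p q : R) : measurable_fun [set: R] (fun x => p * x + q)%R.
  by apply: measurable_funD => //; exact: measurable_funM.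
have a1 : (0 < (1 - d)^-1)%R by rewrite invr_gt0; lra.
have a2 : (0 < (1 + d)^-1)%R by rewrite invr_gt0; lra.
rewrite (lebesgue_measure_affine 0 a1 mA1) (lebesgue_measure_affine (d / (1 + d)) a2 mA2).
rewrite !muleA -!EFinM !mulfV ?mul1e; [|lra|lra].
rewrite unif01_lebesgue// -measureU//; last 3 first.
- by rewrite -[X in measurable X]setTI; exact: maff.
- by rewrite -[X in measurable X]setTI; exact: maff.
- apply/seteqP; split => // x [[_ /=]]; rewrite in_itv/= => /andP[_ h1] [_ /=].
  rewrite in_itv/= => /andP[h2 _]; exfalso.
  have := h1; rewrite addr0 mulrC ltr_pdivrMr; last lra.
  by have := h2; rewrite mulrC -mulrDl ler_pdivlMr; lra.
congr (leb _); apply/seteqP; split => x /=.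
  rewrite in_itv/= /tilt_quantile => -[+ /andP[x0 x1]].
  case: ltP => h Bx; [left|right]; split=> /=; rewrite ?in_itv/=.
  + by rewrite addr0 mulrC.
  + by rewrite addr0 mulrC divr_ge0 ?ltr_pdivrMr; lra.
  + by rewrite mulrC -mulrDl.
  + by rewrite mulrC -mulrDl ler_pdivlMr ?ler_pdivrMr; lra.
rewrite in_itv/= /tilt_quantile; case=> -[] /=; rewrite in_itv/= ?addr0 => Bx.
  rewrite mulrC ltr_pdivrMr; last lra.
  rewrite pmulr_lge0; last by rewrite invr_gt0; lra.
  move=> /andP[x0 x1]; rewrite ifT; last lra.
  by split; [rewrite mulrC|lra].
move: Bx; rewrite mulrC -mulrDl ler_pdivlMr ?ler_pdivrMr; [|lra|lra].
move=> Bx /andP[x0 x1]; rewrite ifF; last by apply/negbTE; rewrite -leNgt; lra.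
by split => //; lra.
Qed.

Lemma tilt_change_of_variables (d : R) (B : set R) :
  (-2^-1 <= d <= 2^-1)%R -> measurable B ->
  unif (tilt_quantile d @^-1` B) = \int[unif]_(u in B) (tilt_density d u)%:E.
Proof.
move=> dd mB; have [d1 d2] := andP dd.
have mt : measurable_fun [set: R] (tilt_density d).
  by apply: measurable_fun_ifT; first exact: measurable_fun_ltr.
have mA1 : measurable (B `&` `[0%R, 2^-1%R[) by exact: measurableI.
have mA2 : measurable (B `&` `[2^-1%R, 1%R]) by exact: measurableI.
rewrite tilt_quantile_law//.
rewrite integral_mkcond integral_unif01; last 2 first.
- by apply/(measurable_restrictT _ _).1 => //; exact/measurable_EFinP/measurable_funTS.
- move=> x; apply: erestrict_ge0 => // u _; rewrite lee_fin /tilt_density.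
  by case: ltP; lra.
rewrite -integral_mkcondr [X in _ = \int[_]_(x in X) _]setIC unit_itv_halves.
rewrite ge0_integral_setU//; last 3 first.
- exact/measurable_EFinP/measurable_funTS.
- by move=> u _; rewrite lee_fin /tilt_density; case: ltP; lra.
- exact: unit_halves_disjoint.
congr (_ + _).
- transitivity (\int[leb]_(x in B `&` `[0%R, 2^-1%R[) cst (1 - d)%:E x).
    by rewrite integral_cst.
  apply: eq_integral => x; rewrite inE => -[_ /=].
  by rewrite in_itv/= /tilt_density => /andP[_ ->].
- transitivity (\int[leb]_(x in B `&` `[2^-1%R, 1%R]) cst (1 + d)%:E x).
    by rewrite integral_cst.
  apply: eq_integral => x; rewrite inE => -[_ /=].
  by rewrite in_itv/= /tilt_density ltNge => /andP[-> _].
Qed.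

Lemma le_integral_uniform (f g : R -> \bar R) :
  measurable_fun [set: R] f -> measurable_fun [set: R] g ->
  (forall x, 0 <= f x) -> (forall x, 0 <= g x) ->
  (forall x, (0 <= x <= 1)%R -> f x <= g x) ->
  \int[unif]_x f x <= \int[unif]_x g x.
Proof.
move=> mf mg f0 g0 fg; rewrite !integral_unif01//.
apply: ge0_le_integral => //; exact: measurable_funTS.
Qed.

End uniform_change_of_variables.

Section finite_attribute.
Local Open Scope ereal_scope.
Context {R : realType} {k : nat}.

Lemma exists_attribute_law (w : 'I_k.+1 -> R) :
  (forall s, 0 <= w s)%R -> (\sum_s w s = 1)%R ->
  exists P : probability 'I_k.+1 R, forall s, P [set s] = (w s)%:E.
Proof.
move=> w0 w1.
pose m i : {measure set 'I_k.+1 -> \bar R} :=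
  mscale (NngNum (w0 (inord i))) (\d_(inord i : 'I_k.+1)).
pose P : {measure set 'I_k.+1 -> \bar R} := msum m k.+1.
have PE A : P A = \sum_(s < k.+1) (w s)%:E * (\1_A s)%:E.
  rewrite /P /= /msum; apply: eq_bigr => s _.
  by rewrite /m /= /mscale /= inord_val diracE indicE.
have PT : P setT = 1.
  rewrite PE; under eq_bigr do rewrite indicT mule1.
  by rewrite sumEFin w1.
pose Q : probability 'I_k.+1 R := HB.pack (P : set _ -> _)
  (Measure.class P) (Measure_isProbability.Build _ _ _ P PT).
exists Q => s; rewrite /Q /= PE (bigD1 s)//= indicE mem_set//= mule1.
rewrite big1 ?adde0// => t ts; rewrite indicE memNset ?mule0//=.
by move=> st; rewrite st eqxx in ts.
Qed.

Lemma integral_attribute (P : probability 'I_k.+1 R) (f : 'I_k.+1 -> \bar R) :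
  (forall s, 0 <= f s) -> \int[P]_s f s = \sum_s f s * P [set s].
Proof.
move=> f0.
have -> : f = fun x => \sum_s (f s * (\1_[set s] x)%:E).
  apply/funext => x; rewrite (bigD1 x)//= indicE mem_set//= mule1.
  rewrite big1 ?adde0// => t ts; rewrite indicE memNset ?mule0//=.
  by move=> st; rewrite st eqxx in ts.
rewrite ge0_integral_sum//.
  apply: eq_bigr => s _; rewrite ge0_integralZl//.
  rewrite integral_indic// setIT; congr (_ * _).
  rewrite (bigD1 s)//= indicE mem_set//= mule1.
  rewrite big1 ?adde0// => t ts; rewrite indicE memNset ?mule0//=.
  by move=> st; rewrite st eqxx in ts.
by move=> s x _; rewrite mule_ge0// lee_fin indicE.
Qed.

End finite_attribute.

(** * Kernels obtained by pushing a fixed law forward *)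

Section pushforward_kernel.
Context {d1 d2 d3 : measure_display} {X : measurableType d1}
  {Y : measurableType d2} {Z : measurableType d3} {R : realType}.
Variables (P : probability Y R) (F : {mfun (X * Y)%type >-> Z}).

Definition fsection (x : X) (y : Y) : Z := F (x, y).

Lemma measurable_fsection x : measurable_fun [set: Y] (fsection x).
Proof.
apply: measurableT_comp; first exact: measurable_funPT.
exact: measurable_pair1.
Qed.

HB.instance Definition _ x :=
  isMeasurableFun.Build _ _ _ _ (fsection x) (measurable_fsection x).

Definition pushforward_kernel (x : X) : {measure set Z -> \bar R} :=
  distribution P (fsection x).

Let measurable_pushforward_kernel U : measurable U ->
  measurable_fun [set: X] (pushforward_kernel ^~ U).
Proof.
move=> mU.
have mFU : measurable (F @^-1` U).
  by rewrite -[X in measurable X]setTI; exact: measurable_funPT.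
have := @measurable_fun_xsection _ _ X Y R P (F @^-1` U) mFU.
apply: eq_measurable_fun => x _; rewrite /pushforward_kernel/= /distribution.
by rewrite /pushforward; congr (P _); apply/seteqP; split => y; rewrite /xsection/= inE.
Qed.

HB.instance Definition _ := isKernel.Build _ _ _ _ _ pushforward_kernel
  measurable_pushforward_kernel.

Let pushforward_kernel_setT x : pushforward_kernel x [set: Z] = 1%E.
Proof. exact: probability_setT. Qed.

HB.instance Definition _ := Kernel_isProbability.Build _ _ _ _ _
  pushforward_kernel pushforward_kernel_setT.

End pushforward_kernel.

(** * The tilted laws *)

Section model.
Context {R : realType} {d k : nat}.
Local Notation attribute := 'I_k.+2.
Local Notation covariate := (d.-tuple R * attribute)%type.
Local Notation observation := (d.-tuple R * R * attribute * R)%type.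
Local Notation unif := (@unif01 R).
Local Open Scope ereal_scope.

Variables (i0 : 'I_d) (c w : R).
Implicit Types (delta : {mfun R >-> R}) (vs : R * attribute) (r u : R).

Definition regression_value (s : attribute) u : R :=
  (if s == ord0 then lumps c u else c * u)%R.

(* All coordinates of [x] carry the same encoding of [(v, u)], so that [V] and [fstar]
   are functions of [(X, S)] in every dimension [d >= 1]. *)
Definition embed (vsu : (R * attribute) * R) : observation :=
  let v := vsu.1.1 in let s := vsu.1.2 in let u := vsu.2 in
  ([tuple encode (v, u) | i < d], v, s, regression_value s u).

(** Turns the rank [r] of the regression value in its group, uniform given (V, S), into the position
    [u]. The covariates record [u] and not [r]: hence [fstar] is free of [delta], and only the law
    of the sample depends on it. *)
Definition level delta vs r : R :=
  if vs.2 == ord0 then tilt_quantile (delta vs.1) r else r.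

Definition sample delta (z : (R * attribute) * R) : observation :=
  embed (z.1, level delta z.1 z.2).

Definition cov_v (x : covariate) : R := decode1 (tnth x.1 i0).
Definition cov_u (x : covariate) : R := decode2 (tnth x.1 i0).

Definition fstar (x : covariate) : R := regression_value x.2 (cov_u x).

(** The explicit fair optimum: the c.d.f. of the group turns the recorded position back into a
    level, at which the barycenter quantile is evaluated. *)
Definition ffair delta (x : covariate) : R :=
  bary_quantile c w (delta (cov_v x))
    (if x.2 == ord0 then tilt_cdf (delta (cov_v x)) (cov_u x) else cov_u x).

Definition sample_density delta (z : observation) : R :=
  if obsS z == ord0 then tilt_density (delta (obsV z)) (cov_u (obsXS z)) else 1%R.

Definition bounded_tilt delta := forall v, (-2^-1 <= delta v <= 2^-1)%R.

Lemma cov_v_embed z : cov_v (obsXS (embed z)) = z.1.1.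
Proof. by rewrite /cov_v /= tnth_mktuple encodeK1. Qed.

Lemma cov_u_embed z : cov_u (obsXS (embed z)) = z.2.
Proof. by rewrite /cov_u /= tnth_mktuple encodeK2. Qed.

Lemma obsVS_embed z : obsVS (embed z) = z.1.
Proof. by case: z => -[]. Qed.

Lemma fstar_sample delta z :
  fstar (obsXS (sample delta z)) = regression_value z.1.2 (level delta z.1 z.2).
Proof. by rewrite /fstar cov_u_embed. Qed.

Lemma ffair_sample delta z : bounded_tilt delta ->
  ffair delta (obsXS (sample delta z)) = bary_quantile c w (delta z.1.1) z.2.
Proof.
move=> bd; rewrite /ffair cov_v_embed cov_u_embed.
rewrite (_ : (obsXS (sample delta z)).2 = z.1.2)// /level /=.
by case: (z.1.2 == ord0) => //; rewrite tilt_quantileK.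
Qed.

Lemma obsY_sample delta z :
  obsY (sample delta z) = fstar (obsXS (sample delta z)).
Proof. by rewrite fstar_sample. Qed.

Section measurability.
Context {dT : measure_display} {T : measurableType dT}.
Implicit Types (f g : T -> R) (s : T -> attribute).

Lemma measurable_eq0 s : measurable_fun setT s ->
  measurable_fun [set: T] (fun t => s t == ord0).
Proof.
move=> ms.
by apply: (@measurableT_comp _ _ _ _ _ _ (fun s : attribute => s == ord0) _ s).
Qed.

Lemma measurable_inv f : measurable_fun [set: T] f ->
  measurable_fun [set: T] (fun t => (f t)^-1)%R.
Proof.
move=> mf; apply: (@measurableT_comp _ _ _ _ _ _ (@GRing.inv R)) => //.
rewrite -(setUv [set 0%R]); apply/measurable_funU => //.
  exact: measurableC.
split; first exact: measurable_fun_set1.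
apply: open_continuous_measurable_fun.
  by apply: closed_openC; exact: closed_eq.
by move=> x /set_mem /eqP x0; exact: inv_continuous.
Qed.

Lemma measurable_divr f g : measurable_fun [set: T] f -> measurable_fun [set: T] g ->
  measurable_fun [set: T] (fun t => f t / g t)%R.
Proof. by move=> mf mg; apply: measurable_funM => //; exact: measurable_inv. Qed.

Lemma measurable_tilt_quantile f g :
  measurable_fun [set: T] f -> measurable_fun [set: T] g ->
  measurable_fun [set: T] (fun t => tilt_quantile (f t) (g t)).
Proof.
move=> mf mg; have m1 : measurable_fun [set: T] (fun t => 1 - f t)%R.
  exact: measurable_funB.
apply: measurable_fun_ifT.
- by apply: measurable_fun_ltr => //; exact: measurable_funM.
- exact: measurable_divr.
- by apply: measurable_divr; exact: measurable_funD.
Qed.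

Lemma measurable_tilt_cdf f g :
  measurable_fun [set: T] f -> measurable_fun [set: T] g ->
  measurable_fun [set: T] (fun t => tilt_cdf (f t) (g t)).
Proof.
move=> mf mg; apply: measurable_fun_ifT.
- exact: measurable_fun_ltr.
- by apply: measurable_funM => //; exact: measurable_funB.
- by apply: measurable_funB => //; apply: measurable_funM => //; exact: measurable_funD.
Qed.

Lemma measurable_tilt_density f g :
  measurable_fun [set: T] f -> measurable_fun [set: T] g ->
  measurable_fun [set: T] (fun t => tilt_density (f t) (g t)).
Proof.
move=> mf mg; apply: measurable_fun_ifT.
- exact: measurable_fun_ltr.
- exact: measurable_funB.
- exact: measurable_funD.
Qed.

Lemma measurable_lumps f : measurable_fun [set: T] f ->
  measurable_fun [set: T] (fun t => lumps c (f t)).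
Proof.
move=> mf; apply: measurable_funM => //; apply: measurable_fun_ifT => //.
- exact: measurable_fun_ltr.
- exact: measurable_funD.
Qed.

Lemma measurable_bary_quantile f g :
  measurable_fun [set: T] f -> measurable_fun [set: T] g ->
  measurable_fun [set: T] (fun t => bary_quantile c w (f t) (g t)).
Proof.
move=> mf mg; apply: measurable_funD; apply: measurable_funM => //.
- by apply: measurable_lumps; exact: measurable_tilt_quantile.
- exact: measurable_funM.
Qed.

Lemma measurable_regression_value s f :
  measurable_fun [set: T] s -> measurable_fun [set: T] f ->
  measurable_fun [set: T] (fun t => regression_value (s t) (f t)).
Proof.
move=> ms mf; apply: measurable_fun_ifT; first exact: measurable_eq0.
- exact: measurable_lumps.
- exact: measurable_funM.
Qed.

End measurability.

Lemma measurable_cov_v : measurable_fun [set: covariate] cov_v.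
Proof.
apply: (measurableT_comp measurable_decode1).
by apply: (measurableT_comp (measurable_tnth i0)).
Qed.

Lemma measurable_cov_u : measurable_fun [set: covariate] cov_u.
Proof.
apply: (measurableT_comp measurable_decode2).
by apply: (measurableT_comp (measurable_tnth i0)).
Qed.

Lemma measurable_fstar : measurable_fun [set: covariate] fstar.
Proof. by apply: measurable_regression_value => //; exact: measurable_cov_u. Qed.

Lemma measurable_delta_cov delta :
  measurable_fun [set: covariate] (delta \o cov_v).
Proof. by apply: measurableT_comp => //; exact: measurable_cov_v. Qed.

Lemma measurable_ffair delta : measurable_fun [set: covariate] (ffair delta).
Proof.
apply: measurable_bary_quantile; first exact: measurable_delta_cov.
apply: measurable_fun_ifT; last exact: measurable_cov_u.
- exact: measurable_eq0.
- by apply: measurable_tilt_cdf; [exact: measurable_delta_cov|exact: measurable_cov_u].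
Qed.

Lemma measurable_level delta :
  measurable_fun [set: (R * attribute) * R] (fun z => level delta z.1 z.2).
Proof.
apply: measurable_fun_ifT => //.
- by apply: measurable_eq0; exact: (measurableT_comp measurable_snd).
- apply: measurable_tilt_quantile => //; apply: measurableT_comp => //.
  exact: (measurableT_comp measurable_fst).
Qed.

Lemma measurable_embed : measurable_fun [set: (R * attribute) * R] embed.
Proof.
have m11 : measurable_fun [set: (R * attribute) * R] (fun z => z.1.1).
  exact: (measurableT_comp measurable_fst).
have m12 : measurable_fun [set: (R * attribute) * R] (fun z => z.1.2).
  exact: (measurableT_comp measurable_snd).
apply: measurable_fun_pair; last exact: measurable_regression_value.
apply: measurable_fun_pair => //; apply: measurable_fun_pair => //.
apply/measurable_fun_tnthP => i.
rewrite (_ : _ \o _ = fun z => encode (z.1.1, z.2)); last first.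
  by apply/funext => z /=; rewrite tnth_mktuple.
apply: (measurableT_comp measurable_encode); exact: measurable_fun_pair.
Qed.

Lemma measurable_sample delta :
  measurable_fun [set: (R * attribute) * R] (sample delta).
Proof.
apply: (measurableT_comp measurable_embed); apply: measurable_fun_pair => //.
exact: measurable_level.
Qed.

HB.instance Definition _ := isMeasurableFun.Build _ _ _ _ embed measurable_embed.
HB.instance Definition _ delta :=
  isMeasurableFun.Build _ _ _ _ (sample delta) (measurable_sample delta).

Lemma measurable_obsX : measurable_fun [set: observation] (@obsX R d k).
Proof. by do 2 apply: (measurableT_comp measurable_fst). Qed.

Lemma measurable_obsV : measurable_fun [set: observation] (@obsV R d k).
Proof. by apply: (measurableT_comp measurable_snd); apply: (measurableT_comp measurable_fst). Qed.

Lemma measurable_obsS : measurable_fun [set: observation] (@obsS R d k).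
Proof. by apply: (measurableT_comp measurable_snd). Qed.

Lemma measurable_obsXS : measurable_fun [set: observation] (@obsXS R d k).
Proof. by apply: measurable_fun_pair; [exact: measurable_obsX|exact: measurable_obsS]. Qed.

Lemma measurable_obsVS : measurable_fun [set: observation] (@obsVS R d k).
Proof. by apply: measurable_fun_pair; [exact: measurable_obsV|exact: measurable_obsS]. Qed.

Lemma measurable_sample_density delta :
  measurable_fun [set: observation] (sample_density delta).
Proof.
apply: measurable_fun_ifT => //.
- by apply: measurable_eq0; exact: measurable_obsS.
- apply: measurable_tilt_density.
    by apply: measurableT_comp => //; exact: measurable_obsV.
  exact: (measurableT_comp measurable_cov_u measurable_obsXS).
Qed.

Lemma sample_density_ge0 delta z : bounded_tilt delta -> (0 <= sample_density delta z)%R.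
Proof.
move=> bd; rewrite /sample_density /tilt_density.
have /andP[] := bd (obsV z).
by case: ifP => // _; case: ifP => _; lra.
Qed.

Variable ws : probability attribute R.

Definition sample_law delta : probability observation R :=
  distribution ((unif \x ws) \x unif) (sample delta).

Lemma sample_lawE delta A :
  sample_law delta A = ((unif \x ws) \x unif) (sample delta @^-1` A).
Proof. by []. Qed.

Lemma sample_law_xsection delta A :
  sample_law delta A =
  \int[unif \x ws]_vs unif (xsection (sample delta @^-1` A) vs).
Proof. by []. Qed.

Lemma integral_sample_law delta (f : observation -> \bar R) :
  measurable_fun setT f -> (forall z, 0 <= f z) ->
  \int[sample_law delta]_z f z =
  \int[unif \x ws]_vs \int[unif]_r f (sample delta (vs, r)).
Proof.
move=> mf f0; rewrite ge0_integral_distribution// fubini_tonelli1//.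
- exact: measurableT_comp.
- by move=> z; exact: f0.
Qed.

End model.

Arguments sample_law : simpl never.

(** * Disintegration along a conditional law *)

Section disintegration.
Local Open Scope ereal_scope.
Context {d1 d2 : measure_display} {T : measurableType d1} {Z : measurableType d2}
  {R : realType}.

Lemma eq_integral_cst1 (P : probability T R) (x : \bar R) : \int[P]_z x = x.
Proof.
transitivity (x * P setT); first exact: integral_cst.
by rewrite probability_setT mule1.
Qed.

(** The cancellation behind the complement step of the Dynkin argument; a sum equal to 1 rules out
    infinite terms. *)
Lemma adde_eq1_inj (x y z : \bar R) : x + y = 1 -> x + z = 1 -> y = z.
Proof.
by case: x y z => [a||] [b||] [e||] //= [h1] [h2]; congr (_%:E); lra.
Qed.

(** A conditional law is specified on rectangles only. These are stable under intersection, and the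
    identity passes to complements, both sides having total mass 1, and to disjoint unions. *)
Lemma disintegration_xsection (P : probability T R) (f : T -> Z) (g : T -> R)
    (mu : R.-pker Z ~> R) :
  measurable_fun setT f -> measurable_fun setT g ->
  (forall A B, measurable A -> measurable B ->
    P ((f @^-1` A) `&` (g @^-1` B)) = \int[P]_(z in f @^-1` A) mu (f z) B) ->
  forall E : set (Z * R), measurable E ->
  P [set z | E (f z, g z)] = \int[P]_z mu (f z) (xsection E (f z)).
Proof.
move=> mf mg cl.
have mphi : measurable_fun [set: T] (fun z => (f z, g z)).
  exact: measurable_fun_pair.
have mpre E : measurable E -> measurable [set z : T | E (f z, g z)].
  by move=> mE; rewrite -[X in measurable X]setTI; exact: mphi.
have mx E : measurable E ->
    measurable_fun [set: T] (fun z => mu (f z) (xsection E (f z))).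
  move=> mE; apply: (measurableT_comp (f := fun x => mu x (xsection E x))).
    by apply: measurable_fun_xsection_finite_kernel; rewrite inE.
  exact: mf.
move=> E; rewrite [X in X E](_ : _ = <<s
    [set A `*` B | A in @measurable _ Z & B in @measurable _ R] >>);
  last exact: measurable_prod_measurableType.
move: E; apply: dynkin_induction.
- exact: measurable_prod_measurableType.
- move=> _ _ [A1 mA1 [B1 mB1 <-]] [A2 mA2 [B2 mB2 <-]].
  rewrite -setXI; exists (A1 `&` A2); first exact: measurableI.
  by exists (B1 `&` B2) => //; exact: measurableI.
- rewrite (_ : [set _ | _] = setT)// probability_setT.
  rewrite -[LHS](eq_integral_cst1 P); apply: eq_integral => z _.
  transitivity (mu (f z) setT); first exact/esym/prob_kernel.
  congr (mu _ _); by apply/seteqP; split => y //= _; rewrite /xsection/= inE.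
- move=> _ [A mA [B mB <-]].
  have -> : [set z : T | (A `*` B) (f z, g z)] =
    (f @^-1` A) `&` ((fun z => g z) @^-1` B) by [].
  rewrite cl// integral_mkcond; apply: eq_integral => z _; rewrite patchE.
  have -> : (z \in f @^-1` A) = (f z \in A) by [].
  by case: ifPn => zA; [rewrite in_xsectionX|rewrite notin_xsectionX// measure0].
- move=> S mS IH; rewrite /= in IH *.
  have mC : measurable (~` S) by exact: measurableC.
  have E1 : P [set z | S (f z, g z)] +
            P [set z | (~` S) (f z, g z)] = 1.
    rewrite -measureU//; last 3 first.
    + exact: mpre.
    + exact: mpre.
    + by apply/seteqP; split => z //= [].
    rewrite -[RHS](probability_setT P); congr (P _).
    by apply/seteqP; split => z //= _; exact: EM.
  have E2 : \int[P]_z mu (f z) (xsection S (f z)) +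
            \int[P]_z mu (f z) (xsection (~` S) (f z)) = 1.
    rewrite -ge0_integralD//; last 2 first.
    + exact: mx.
    + exact: mx.
    rewrite -[RHS](eq_integral_cst1 P); apply: eq_integral => z _.
    rewrite -measureU//; last 3 first.
    + exact: measurable_xsection.
    + exact: measurable_xsection.
    + by apply/seteqP; split => y; rewrite /xsection/= !inE// => -[].
    transitivity (mu (f z) setT); last exact: prob_kernel.
    congr (mu _ _).
    by apply/seteqP; split => y //= _; rewrite /xsection/= !inE; exact: EM.
  by apply: (adde_eq1_inj E1); rewrite IH.
- move=> F mF tF IH; rewrite /= in IH *.
  have -> : [set z : T | (\bigcup_n F n) (f z, g z)] =
      \bigcup_n [set z | F n (f z, g z)] by [].
  rewrite measure_semi_bigcup//; last 3 first.
  + by move=> n; exact: mpre.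
  + apply/trivIsetP => i j _ _ ij; move/trivIsetP : tF => /(_ i j Logic.I Logic.I ij) FF.
    apply/seteqP; split => z //= [Fi Fj].
    by have : (F i `&` F j) (f z, g z) by []; rewrite FF.
  + by apply: bigcup_measurable => n _; exact: mpre.
  rewrite (eq_eseriesr (fun n _ => IH n)).
  rewrite -integral_nneseries//; last by move=> n; exact: mx.
  apply: eq_integral => z _; rewrite xsection_bigcup measure_semi_bigcup//.
  + by move=> n; exact: measurable_xsection.
  + exact: trivIset_xsection.
  + by apply: bigcup_measurable => n _; exact: measurable_xsection.
Qed.

Lemma integral_disintegration (P : probability T R) (f : T -> Z) (g : T -> R)
    (mu : R.-pker Z ~> R) (h : Z * R -> \bar R) :
  measurable_fun setT f -> measurable_fun setT g ->
  (forall A B, measurable A -> measurable B ->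
    P ((f @^-1` A) `&` (g @^-1` B)) = \int[P]_(z in f @^-1` A) mu (f z) B) ->
  measurable_fun setT h -> (forall x, 0 <= h x) ->
  \int[P]_z h (f z, g z) = \int[P]_z \int[mu (f z)]_y h (f z, y).
Proof.
move=> mf mg cl; move: h.
have mphi : measurable_fun [set: T] (fun z => (f z, g z)).
  exact: measurable_fun_pair.
have mh (h : Z * R -> \bar R) : measurable_fun setT h ->
    measurable_fun setT (fun z : T => h (f z, g z)).
  by move=> mh; exact: (measurableT_comp mh mphi).
have mhx (h : Z * R -> \bar R) vs : measurable_fun setT h ->
    measurable_fun setT (fun y => h (vs, y)).
  by move=> mh'; exact: (measurableT_comp mh').
have mI (h : Z * R -> \bar R) : measurable_fun setT h ->
    (forall x, 0 <= h x) ->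
    measurable_fun setT (fun z : T => \int[mu (f z)]_y h (f z, y)).
  move=> mh' h0; apply: (measurableT_comp (f := fun x => \int[mu x]_y h (x, y))).
    exact: measurable_fun_integral_finite_kernel.
  exact: mf.
have I0 (h : Z * R -> \bar R) : (forall x, 0 <= h x) ->
    forall z, 0 <= \int[mu (f z)]_y h (f z, y).
  by move=> h0 z; exact: integral_ge0.
apply: ge0_measurable_ind.
- move=> E mE.
  transitivity (P [set z | E (f z, g z)]).
    rewrite -[in RHS](setIT [set z | _]) -integral_indic//.
    by rewrite -[X in measurable X]setTI; exact: mphi.
  rewrite (disintegration_xsection mf mg cl)//; apply: eq_integral => z _.
  transitivity (\int[mu (f z)]_y (\1_(xsection E (f z)) y)%:E).
    by rewrite integral_indic ?setIT//; exact: measurable_xsection.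
  by apply: eq_integral => y _; rewrite !indicE mem_xsection.
- move=> f1 f2 mf1 f10 mf2 f20 IH1 IH2.
  rewrite (ge0_integralD P measurableT (fun z _ => f10 _) (mh _ mf1)
    (fun z _ => f20 _) (mh _ mf2)) IH1 IH2.
  rewrite -(ge0_integralD P measurableT
    (fun z _ => I0 _ f10 z) (mI _ mf1 f10)
    (fun z _ => I0 _ f20 z) (mI _ mf2 f20)).
  apply: eq_integral => z _.
  exact/esym/(ge0_integralD _ measurableT (fun y _ => f10 _) (mhx _ _ mf1)
    (fun y _ => f20 _) (mhx _ _ mf2)).
- move=> r f1 r0 mf1 f10 IH; rewrite ge0_integralZl//; last exact: mh.
  rewrite IH -ge0_integralZl//; last 2 first.
  + exact: mI.
  + by move=> z _; exact: integral_ge0.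
  by apply: eq_integral => z _; rewrite ge0_integralZl//; exact: mhx.
- move=> u mu_ u0 ndu IH.
  rewrite monotone_convergence//; last by move=> n; exact: mh.
  under eq_fun do rewrite IH.
  rewrite -monotone_convergence//; last 3 first.
  + by move=> n; exact: mI.
  + by move=> n z _; exact: integral_ge0.
  + move=> z _ m n mn; apply: ge0_le_integral => //; try exact: mhx.
    by move=> y _; exact: ndu.
  apply: eq_integral => z _; rewrite -monotone_convergence//.
  by move=> n; exact: mhx.
Qed.

End disintegration.

(** * Conditional laws of the model and membership in the class *)

Section model_properties.
Context {R : realType} {d k : nat}.
Local Notation attribute := 'I_k.+2.
Local Notation covariate := (d.-tuple R * attribute)%type.
Local Notation observation := (d.-tuple R * R * attribute * R)%type.
Local Notation unif := (@unif01 R).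
Local Open Scope ereal_scope.

Variables (i0 : 'I_d) (c w : R) (ws : probability attribute R).
Implicit Types (delta : {mfun R >-> R}).

Local Notation sample := (@sample R d k c).
Local Notation sample_law := (@sample_law R d k c ws).

(** The level [r] ranges over all of R with a law carried by [0, 1], and the bounds on the model
    hold only there; hence the restriction in the pointwise hypothesis. *)
Lemma le_integral_sample_law delta (f g : observation -> \bar R) :
  measurable_fun setT f -> (forall z, 0 <= f z) ->
  measurable_fun setT g -> (forall z, 0 <= g z) ->
  (forall vs r, (0 <= r <= 1)%R -> f (sample delta (vs, r)) <= g (sample delta (vs, r))) ->
  \int[sample_law delta]_z f z <= \int[sample_law delta]_z g z.
Proof.
move=> mf f0 mg g0 fg; rewrite !integral_sample_law//.
have mh (h : observation -> \bar R) : measurable_fun setT h ->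
    measurable_fun setT (fun z => h (sample delta z)).
  by move=> mh; exact: measurableT_comp.
apply: ge0_le_integral => //.
- by move=> vs _; exact: integral_ge0.
- exact: (@measurable_fun_fubini_tonelli_F _ _ _ _ _ unif
    (fun z => f (sample delta z)) (mh _ mf) (fun z => f0 _)).
- exact: (@measurable_fun_fubini_tonelli_F _ _ _ _ _ unif
    (fun z => g (sample delta z)) (mh _ mg) (fun z => g0 _)).
move=> vs _; apply: le_integral_uniform => //.
- exact: (measurableT_comp (mh _ mf)).
- exact: (measurableT_comp (mh _ mg)).
- by move=> r; exact: fg.
Qed.

Lemma sample_law_ae delta (f g : observation -> R) :
  measurable_fun setT f -> measurable_fun setT g ->
  (forall z, f (sample delta z) = g (sample delta z)) ->
  {ae sample_law delta, forall z, f z = g z}.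
Proof.
move=> mf mg fg; exists [set z | f z != g z]; split.
- rewrite (_ : [set z | _] = (f \- g)%R @^-1` (~` [set 0%R])); last first.
    apply/seteqP; split=> z /=; first by rewrite -subr_eq0 => /eqP.
    by move=> /eqP; rewrite subr_eq0.
  rewrite -[X in measurable X]setTI; apply: measurable_funB => //.
  exact: measurableC.
- rewrite sample_lawE (_ : _ @^-1` _ = set0) ?measure0//.
  by apply/seteqP; split => z //=; rewrite fg eqxx.
- by move=> z /= /eqP.
Qed.

Lemma sample_law_obsVS delta (E : set (R * attribute)) : measurable E ->
  sample_law delta (@obsVS R d k @^-1` E) = (unif \x ws) E.
Proof.
move=> mE; rewrite sample_lawE.
rewrite (_ : _ @^-1` _ = E `*` setT); last first.
  by apply/seteqP; split => -[[v s] r] //= [].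
by rewrite product_measure1E//= probability_setT mule1.
Qed.

Lemma data_generating_sample_law delta (ww : attribute -> R) :
  (forall s, ws [set s] = (ww s)%:E) -> data_generating ww (sample_law delta).
Proof.
move=> wsE.
have VS (A : set R) (B : set attribute) : measurable A ->
    sample_law delta ((@obsV R d k @^-1` A) `&` (@obsS R d k @^-1` B)) = unif A * ws B.
  by move=> mA; rewrite -product_measure1E// -(sample_law_obsVS delta)//; exact: measurableX.
have V (A : set R) : measurable A -> sample_law delta (@obsV R d k @^-1` A) = unif A.
  by move=> mA; have := VS A setT mA; rewrite preimage_setT setIT probability_setT mule1.
have S (B : set attribute) : sample_law delta (@obsS R d k @^-1` B) = ws B.
  by have := VS setT B measurableT; rewrite preimage_setT setTI probability_setT mul1e.
split.
- by move=> s; rewrite S.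
- by move=> A mA; rewrite V// unif01E.
- by move=> A B mA mB; rewrite VS// V// S.
- exists (cov_v i0); first exact: measurable_cov_v.
  apply: sample_law_ae => //; first exact: measurable_obsV.
    exact: (measurableT_comp (measurable_cov_v i0) measurable_obsXS).
  by move=> z; rewrite cov_v_embed.
Qed.

(** Given (V, S), the only randomness left is the uniform level, so the conditional law of [f] is
    the image of the uniform law under a section of [F]. *)
Lemma is_cond_law_sample_law delta (f : covariate -> R)
    (F : {mfun ((R * attribute) * R)%type >-> R}) :
  measurable_fun setT f -> (forall z, f (obsXS (sample delta z)) = F z) ->
  is_cond_law (sample_law delta) f (pushforward_kernel unif F).
Proof.
move=> mf fF A B mA mB.
have mk : measurable_fun setT ((fun vs => pushforward_kernel unif F vs B) \_ A).
  by apply/(measurable_restrictT _ _).1 => //; apply: measurable_funTS; exact: measurable_kernel.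
rewrite integral_mkcond (_ : _ \_ _ =
    ((fun vs => pushforward_kernel unif F vs B) \_ A) \o @obsVS R d k); last first.
  by apply/funext => z; rewrite /= !patchE.
rewrite integral_sample_law; last 2 first.
- exact: (measurableT_comp mk measurable_obsVS).
- by move=> z; apply: erestrict_ge0.
rewrite sample_law_xsection; apply: eq_integral => vs _.
transitivity (\int[unif]_r ((fun vs => pushforward_kernel unif F vs B) \_ A) vs);
  last by apply: eq_integral => r _; rewrite /= obsVS_embed.
rewrite eq_integral_cst1 patchE.
have -> : xsection (sample delta @^-1` ((@obsVS R d k @^-1` A) `&`
    (fun z => f (obsXS z)) @^-1` B)) vs =
    if vs \in A then [set r | B (F (vs, r))] else set0.
  apply/seteqP; split => r; rewrite /xsection/= inE/= fF obsVS_embed /=.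
    by move=> [Avs BF]; rewrite mem_set.
  by case: ifP => // /set_mem.
by case: ifP => // _; rewrite measure0.
Qed.

Definition fair_value delta (z : (R * attribute) * R) : R :=
  bary_quantile c w (delta z.1.1) z.2.

Lemma measurable_delta11 delta :
  measurable_fun [set: (R * attribute) * R] (fun z => delta z.1.1).
Proof. by apply: measurableT_comp => //; exact: (measurableT_comp measurable_fst). Qed.

Lemma measurable_fair_value delta : measurable_fun setT (fair_value delta).
Proof. by apply: measurable_bary_quantile => //; exact: measurable_delta11. Qed.

HB.instance Definition _ delta :=
  isMeasurableFun.Build _ _ _ _ (fair_value delta) (measurable_fair_value delta).

Definition fstar_value delta (z : (R * attribute) * R) : R :=
  regression_value c z.1.2 (level delta z.1 z.2).

Lemma measurable_fstar_value delta : measurable_fun setT (fstar_value delta).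
Proof.
apply: measurable_regression_value; last exact: measurable_level.
exact: (measurableT_comp measurable_snd).
Qed.

HB.instance Definition _ delta :=
  isMeasurableFun.Build _ _ _ _ (fstar_value delta) (measurable_fstar_value delta).

(** [fair_value] does not look at the attribute, so the conditional laws coincide at every [v]. *)
Lemma fair_ffair delta : bounded_tilt delta ->
  fair (sample_law delta) (ffair i0 c w delta).
Proof.
move=> bd; exists (pushforward_kernel unif (fair_value delta)).
  apply: is_cond_law_sample_law; first exact: measurable_ffair.
  by move=> z; rewrite ffair_sample.
exact: aeW.
Qed.

Lemma regression_value_bounds s u : (0 <= c)%R -> (0 <= u <= 1)%R ->
  (0 <= @regression_value R k c s u <= 2 * c)%R.
Proof.
move=> c0 u01; rewrite /regression_value; case: ifP => _.
  exact: lumps_bounds.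
by case/andP: u01 => u0 u1; apply/andP; split; nra.
Qed.

Lemma level_bounds delta vs r : bounded_tilt delta -> (0 <= r <= 1)%R ->
  (0 <= @level R k delta vs r <= 1)%R.
Proof.
by move=> bd r01; rewrite /level; case: ifP => // _; exact: tilt_quantile01.
Qed.

Lemma fstar_value_bounds delta vs r : (0 <= c)%R -> bounded_tilt delta ->
  (0 <= r <= 1)%R -> (0 <= fstar_value delta (vs, r) <= 2 * c)%R.
Proof.
by move=> c0 bd r01; apply: regression_value_bounds => //; exact: level_bounds.
Qed.

Lemma measurable_fstarXS :
  measurable_fun [set: observation] (fun z => fstar i0 c (obsXS z)).
Proof. exact: (measurableT_comp (measurable_fstar i0 c) measurable_obsXS). Qed.

Lemma is_regression_fstar delta : (0 <= c)%R -> bounded_tilt delta ->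
  is_regression (sample_law delta) (fstar i0 c).
Proof.
move=> c0 bd.
have int (f : observation -> R) : measurable_fun setT f ->
    (forall z, f (sample delta z) = fstar_value delta z) ->
    (sample_law delta).-integrable setT (fun z => (f z)%:E).
  move=> mf fE; apply/integrableP; split; first exact/measurable_EFinP.
  apply: (@le_lt_trans _ _ (\int[sample_law delta]_z (2 * c)%:E)); last first.
    by rewrite eq_integral_cst1 ltry.
  apply: le_integral_sample_law => //.
  - by apply: measurableT_comp => //; exact/measurable_EFinP.
  - by move=> z; rewrite lee_fin mulr_ge0.
  - move=> vs r r01; rewrite fE /= lee_fin.
    by have /andP[h1 h2] := fstar_value_bounds vs c0 bd r01; rewrite ger0_norm.
split.
- exact: measurable_fstar.
- by apply: int => //; exact: measurable_snd.
- apply: int; first exact: measurable_fstarXS.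
  by move=> z; rewrite fstar_sample.
- move=> A mA.
  have mXA : measurable (@obsXS R d k @^-1` A).
    by rewrite -[X in measurable X]setTI; exact: measurable_obsXS.
  apply: ae_eq_integral => //.
  + by apply/measurable_EFinP/measurable_funTS; exact: measurable_fstarXS.
  + by apply/measurable_EFinP/measurable_funTS; exact: measurable_snd.
  + have := @sample_law_ae delta (fun z => fstar i0 c (obsXS z)) (@obsY R d k).
    move=> /(_ measurable_fstarXS measurable_snd).
    have h (z : (R * attribute) * R) := esym (obsY_sample i0 c delta z).
    by move=> /(_ h); apply: filterS => z /= -> _.
Qed.

(** For non-atomicity: an injective image of the uniform law has no atoms. *)
Lemma fstar_value_inj delta vs : (0 < c)%R -> bounded_tilt delta ->
  injective (fun r => fstar_value delta (vs, r)).
Proof.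
move=> c0 bd r r'; rewrite /fstar_value /regression_value /level /=.
case: (vs.2 == ord0).
  by move=> /(lumps_inj c0)/(can_inj (tilt_quantileK (bd _))).
by move=> /(mulfI (lt0r_neq0 c0)).
Qed.

Lemma unif01_set1 r : unif [set r] = 0.
Proof.
apply/eqP; rewrite eq_le measure_ge0 andbT unif01_lebesgue//.
rewrite -(lebesgue_measure_set1 r) le_measure ?inE//.
exact: measurableI.
Qed.

Lemma lipschitz_class_sample_law delta (ww : attribute -> R) (L : R) :
  (0 < c)%R -> bounded_tilt delta ->
  (forall v v', `|delta v - delta v'| <= L * `|v - v'|)%R ->
  (forall s, ws [set s] = (ww s)%:E) -> (0 <= L)%R ->
  lipschitz_class ww (2 * c) L (sample_law delta).
Proof.
move=> c0 bd lipd wsE L0; split; first exact: data_generating_sample_law.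
exists (fstar i0 c), (pushforward_kernel unif (fstar_value delta)).
have kE vs B : pushforward_kernel unif (fstar_value delta) vs B =
    unif [set r | B (fstar_value delta (vs, r))] by [].
have mset vs (B : set R) : measurable B ->
    measurable [set r | B (fstar_value delta (vs, r))].
  move=> mB; rewrite -[X in measurable X]setTI.
  exact: (measurable_fsection (fstar_value delta) vs measurableT mB).
split.
- by apply: is_regression_fstar => //; exact: ltW.
- apply: is_cond_law_sample_law; first exact: measurable_fstar.
  by move=> z; rewrite fstar_sample.
- move=> v s _; split.
    move=> t; rewrite kE.
    have [[r rt]|nex] := pselect (exists r, fstar_value delta ((v, s), r) = t).
      rewrite (_ : [set _ | _] = [set r]) ?unif01_set1//.
      apply/seteqP; split => r' /=; last by move=> ->.
      by rewrite -rt => /(fstar_value_inj c0 bd).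
    rewrite (_ : [set _ | _] = set0) ?measure0//.
    by apply/seteqP; split => r //= rt; apply: nex; exists r.
  rewrite kE; apply/eqP; rewrite eq_le; apply/andP; split.
    by apply: probability_le1; exact: mset.
  rewrite -(_ : unif [set` `[0%R, 1%R]] = 1); last first.
    by rewrite unif01_lebesgue// setIid lebesgue_measure_itv/= lte01 oppr0 adde0.
  apply: le_measure; rewrite ?inE//; first exact: mset.
  move=> r /=; rewrite !in_itv/= => r01.
  have /andP[h1 h2] := fstar_value_bounds (v, s) (ltW c0) bd r01.
  by rewrite h2 andbT (le_trans _ h1)// lerNl oppr0 mulr_ge0// ltW.
- move=> s t [v v'] _ /=.
  rewrite /cond_cdf !kE; set I : set R := [set` `]-oo, t]].
  case: (eqVneq s ord0) => [->|s0]; last first.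
    have -> : [set r | I (fstar_value delta (v, s, r))] =
              [set r | I (fstar_value delta (v', s, r))].
      by rewrite /fstar_value /level /= (negbTE s0).
    by rewrite subrr normr0 mulr_ge0.
  pose B := [set u | (lumps c u <= t)%R].
  have mB : measurable B.
    rewrite -[X in measurable X]setTI.
    have ml : measurable_fun [set: R] (lumps c) by exact: measurable_lumps.
    rewrite (_ : B = lumps c @^-1` I); first exact: (ml measurableT I (measurable_itv _)).
    by apply/seteqP; split => u; rewrite /B /I /= in_itv.
  have E x : [set r | I (fstar_value delta ((x, ord0 : attribute), r))] =
      tilt_quantile (delta x) @^-1` B.
    by apply/seteqP; split => r; rewrite /B /I /= in_itv.
  (* [B] does not depend on [v], and the c.d.f. is affine in the tilt: (1 - delta v) a + (1 + delta
     v) b, where [a] and [b] are the measures of the parts of [B] in the two halves of [0, 1]. As a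
     + b <= 1, its slope b - a is at most 1 in absolute value. *)
  rewrite !E !tilt_quantile_law//.
  set A1 := B `&` _; set A2 := B `&` _.
  have mA1 : measurable A1 by exact: measurableI.
  have mA2 : measurable A2 by exact: measurableI.
  have A12 : @lebesgue_measure R A1 + @lebesgue_measure R A2 <= 1.
    have : unif B <= 1 by exact: probability_le1.
    rewrite unif01_lebesgue// unit_itv_halves measureU//.
    by apply/seteqP; split=> // x; exact: (disj_setPS (unit_halves_disjoint B)).
  have real_parts (x y : \bar R) : 0 <= x -> 0 <= y -> x + y <= 1 ->
      exists a b, [/\ x = a%:E, y = b%:E, (0 <= a)%R & (0 <= b)%R].
    by case: x y => [a||] [b||] //; rewrite !lee_fin => ? ? _; exists a, b.
  have [a [b [aE bE a0 b0]]] := real_parts (@lebesgue_measure R A1)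
    (@lebesgue_measure R A2) (measure_ge0 (@lebesgue_measure R) A1)
    (measure_ge0 (@lebesgue_measure R) A2) A12.
  move: A12; rewrite aE bE -EFinD lee_fin => ab /=.
  rewrite (_ : (_ - _)%R = ((delta v - delta v') * (b - a))%R); last by ring.
  rewrite normrM (le_trans _ (lipd v v'))// ler_piMr//.
  by rewrite ler_norml; apply/andP; split; lra.
Qed.

End model_properties.

(** * Optimality of the barycenter among fair predictors *)

Section fair_optimality.
Context {R : realType} {d k : nat}.
Local Notation attribute := 'I_k.+2.
Local Notation covariate := (d.-tuple R * attribute)%type.
Local Notation observation := (d.-tuple R * R * attribute * R)%type.
Local Notation unif := (@unif01 R).
Local Open Scope ereal_scope.

Variables (i0 : 'I_d) (c : R) (ws : probability attribute R).
Implicit Types (delta : {mfun R >-> R}).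
Local Notation sample := (@sample R d k c).
Local Notation sample_law := (@sample_law R d k c ws).

(** For almost every [v], fairness lets the conditional law given (v, ord0) replace those of all the
    groups. The sum over the groups then moves inside a single integral, whose integrand is the
    constant [K]. *)
Lemma fair_mean delta (f : covariate -> R) (h : (R * attribute) * R -> \bar R) (K : \bar R) :
  measurable_fun setT f -> fair (sample_law delta) f ->
  measurable_fun setT h -> (forall x, 0 <= h x) ->
  (forall v y, \sum_s h (v, s, y) * ws [set s] = K) ->
  \int[sample_law delta]_z h (obsVS z, f (obsXS z)) = K.
Proof.
move=> mf [mu cl [N [mN N0 subN]]] mh h0 hK.
pose G vs := \int[mu vs]_y h (vs, y).
have mG : measurable_fun setT G by exact: measurable_fun_integral_finite_kernel.
have G0 vs : 0 <= G vs by exact: integral_ge0.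
have mhx vs : measurable_fun setT (fun y => h (vs, y)).
  exact: (measurableT_comp mh).
rewrite (integral_disintegration measurable_obsVS
  (measurableT_comp mf measurable_obsXS) cl mh h0).
transitivity (\int[sample_law delta]_z (G \o @obsVS R d k) z); first by [].
rewrite integral_sample_law; last 2 first.
- exact: (measurableT_comp mG measurable_obsVS).
- by move=> z; exact: G0.
transitivity (\int[unif \x ws]_vs G vs).
  apply: eq_integral => vs _; rewrite -[RHS](eq_integral_cst1 unif).
  by apply: eq_integral => r _; rewrite /= obsVS_embed.
rewrite fubini_tonelli1// -[RHS](eq_integral_cst1 unif).
have K0 : 0 <= K by rewrite -(hK 0%R 0%R); apply: sume_ge0 => s _; exact: mule_ge0.
apply: ge0_ae_eq_integral => //.
- exact: measurable_fun_fubini_tonelli_F.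
- by move=> v _; exact: integral_ge0.
exists N; split; [exact: mN|by have := unif01E N; rewrite N0|].
move=> v nv; apply: subN => /= mus; apply: nv => /= _.
rewrite /fubini_F integral_attribute//.
transitivity (\sum_s \int[mu (v, ord0)]_y (h (v, s, y) * ws [set s])).
  apply: eq_bigr => s _; rewrite ge0_integralZr//; congr (_ * _).
  by apply: eq_measure_integral => A mA _; exact: mus.
rewrite -ge0_integral_sum//.
- under eq_integral do rewrite hK.
  transitivity (K * mu (v, ord0) setT); first exact: integral_cst.
  by rewrite prob_kernel mule1.
- by move=> s; apply: emeasurable_funM.
- by move=> s y _; exact: mule_ge0.
Qed.

End fair_optimality.

Section optimality.
Context {R : realType} {d k : nat}.
Local Notation attribute := 'I_k.+2.
Local Notation covariate := (d.-tuple R * attribute)%type.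
Local Notation observation := (d.-tuple R * R * attribute * R)%type.
Local Notation unif := (@unif01 R).
Local Open Scope ereal_scope.

Lemma measurable_brenier (dT : measure_display) (T : measurableType dT)
    (c w : R) (f g : T -> R) :
  measurable_fun [set: T] f -> measurable_fun [set: T] g ->
  measurable_fun [set: T] (fun t => brenier c w (f t) (g t)).
Proof.
move=> mf mg.
have m1 : measurable_fun [set: T] (fun t => 1 - f t)%R by exact: measurable_funB.
have m2 : measurable_fun [set: T] (fun t => 1 + f t)%R by exact: measurable_funD.
have mlo : measurable_fun [set: T] (fun t => slope_lo w (f t)).
  by apply: measurable_inv; apply: measurable_funD => //; exact: measurable_divr.
have mhi : measurable_fun [set: T] (fun t => slope_hi w (f t)).
  by apply: measurable_inv; apply: measurable_funD => //; exact: measurable_divr.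
have mj : measurable_fun [set: T] (fun t => jump_lo c w (f t)).
  by apply: measurable_funM => //; apply: measurable_funD => //;
    apply: measurable_funM => //; exact: measurable_funM.
apply: measurable_funD; last first.
  by apply: measurable_funM => //; apply: measurable_funM => //; exact: measurable_funM.
apply: measurable_funD; apply: measurable_funM; try exact: measurable_funM.
- apply: measurable_funX; apply: measurable_minr => //.
  exact: measurable_funB.
- apply: measurable_funX; apply: measurable_maxr => //.
  by apply: measurable_funB => //; exact: measurable_funD.
Qed.

(** Allows the potential to be shifted to a nonnegative function, so that the optimality proof needs
    no integrability of the competitor, whose squared error may be infinite. *)
Lemma potential_bounded (c w : R) : (0 < c)%R -> (0 < w)%R -> (w < 1)%R ->
  exists2 B : R, (0 <= B)%R & forall d first y, (-2^-1 <= d <= 2^-1)%R ->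
    (0 <= y <= 2 * c)%R -> (`|potential c w d first y| <= B)%R.
Proof.
move=> c0 w0 w1; pose S := ((1 - w)^-1)%R.
have S0 : (0 < S)%R by rewrite invr_gt0 subr_gt0.
(* 4 c^2 for y^2, plus twice the bound [br] on [brenier]. *)
pose B0 := (8 * c ^+ 2 + 8 * S * c ^+ 2)%R.
have B00 : (0 <= B0)%R by rewrite addr_ge0// !mulr_ge0// ?sqr_ge0// ltW.
have q0 : (0 < (1 - w) / w)%R by rewrite divr_gt0// subr_gt0.
exists (B0 * (1 + (1 - w) / w))%R; first by rewrite mulr_ge0// addr_ge0// ltW.
move=> e first y e_bnd /andP[y0 y1].
have br : (0 <= brenier c w e y <= 2 * c ^+ 2 + 4 * S * c ^+ 2)%R.
  have /andP[l0 l1] := slope_lo_bnd w0 w1 e_bnd; rewrite -/S in l1.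
  have /andP[h0 h1] := slope_hi_bnd w0 w1 e_bnd; rewrite -/S in h1.
  have [j0 j1] : (0 <= jump_lo c w e)%R /\ (jump_lo c w e <= c)%R.
    rewrite /jump_lo; case/andP: e_bnd => e0 e1.
    have p1 : (0 <= (1 - w) * ((1 - e) / 2))%R by rewrite mulr_ge0//; lra.
    have p2 : ((1 - w) * ((1 - e) / 2) <= 1 - w)%R by rewrite ler_piMr//; lra.
    by split; [rewrite mulr_ge0//; lra|rewrite ler_piMr//; lra].
  have cw : (0 <= c * w)%R by rewrite mulr_ge0// ltW.
  have sq (z : R) : (`|z| <= 2 * c)%R -> (0 <= z ^+ 2 <= 4 * c ^+ 2)%R.
    move=> zc; rewrite sqr_ge0/= -(ger0_norm (sqr_ge0 z)) normrX.
    rewrite (_ : (4 * c ^+ 2)%R = ((2 * c) ^+ 2)%R); last by ring.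
    by rewrite ler_pXn2r// ?nnegrE//; lra.
  have /andP[m0 m1] : (0 <= (Num.min (y - jump_lo c w e) 0) ^+ 2 <= 4 * c ^+ 2)%R.
    by apply: sq; case: (leP (y - jump_lo c w e)%R 0%R) => h;
      rewrite ?normr0 ?ler0_norm//; lra.
  have /andP[n0 n1] : (0 <= (Num.max (y - (jump_lo c w e + c * w)) 0) ^+ 2 <= 4 * c ^+ 2)%R.
    by apply: sq; case: (leP (y - (jump_lo c w e + c * w))%R 0%R) => h;
      rewrite ?normr0 ?gtr0_norm//; lra.
  have [z0 z1] : (0 <= c * ((1 - e) / 2) * y)%R /\ (c * ((1 - e) / 2) * y <= 2 * c ^+ 2)%R.
    case/andP: e_bnd => e0 e1.
    have ce : (0 <= c * ((1 - e) / 2) <= c)%R.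
      by rewrite mulr_ge0 ?ler_piMr//; lra.
    case/andP: ce => ce0 ce1; split; first by rewrite mulr_ge0.
    rewrite (_ : (2 * c ^+ 2)%R = (c * (2 * c))%R); last by ring.
    exact: ler_pM.
  have a1 : (0 <= slope_lo w e / 2 * Num.min (y - jump_lo c w e) 0 ^+ 2 <= S / 2 * (4 * c ^+ 2))%R.
    by apply/andP; split; [rewrite mulr_ge0//; lra|apply: ler_pM => //; lra].
  have a2 : (0 <= slope_hi w e / 2 * Num.max (y - (jump_lo c w e + c * w)) 0 ^+ 2
      <= S / 2 * (4 * c ^+ 2))%R.
    by apply/andP; split; [rewrite mulr_ge0//; lra|apply: ler_pM => //; lra].
  case/andP: a1 => a10 a11; case/andP: a2 => a20 a21.
  by rewrite /brenier; apply/andP; split; lra.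
have base : (`|y ^+ 2 - 2 * brenier c w e y| <= B0)%R.
  case/andP: br => b0 b1.
  have y2 : (0 <= y ^+ 2 <= 4 * c ^+ 2)%R.
    by rewrite sqr_ge0/=; nra.
  case/andP: y2 => y20 y21.
  by rewrite ler_norml /B0; apply/andP; split; lra.
rewrite /potential; case: first; last first.
  by rewrite (le_trans base)// ler_peMr// lerDl ltW.
rewrite normrM normrN (gtr0_norm q0) mulrC.
by apply: ler_pM => //; [exact: ltW|lra].
Qed.

Variables (i0 : 'I_d) (c w : R) (ws : probability attribute R).
Implicit Types (delta : {mfun R >-> R}).
Local Notation sample := (@sample R d k c).
Local Notation sample_law := (@sample_law R d k c ws).

Lemma measurable_ffairXS delta :
  measurable_fun [set: observation] (fun z => ffair i0 c w delta (obsXS z)).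
Proof. exact: (measurableT_comp (measurable_ffair i0 c w delta) measurable_obsXS). Qed.

Lemma optimal_ffair delta (ww : attribute -> R) :
  (0 < c)%R -> bounded_tilt delta ->
  (forall s, ws [set s] = (ww s)%:E) -> (forall s, 0 < ww s)%R ->
  (\sum_s ww s = 1)%R -> w = ww ord0 -> (w < 1)%R ->
  optimal_fair (sample_law delta) (ffair i0 c w delta).
Proof.
move=> c0 bd wsE ww0 ww1 wE w_lt1.
have w_gt0 : (0 < w)%R by rewrite wE.
have ff := fair_ffair i0 c w ws bd.
split=> //; first exact: measurable_ffair.
exists (fstar i0 c); first by apply: is_regression_fstar => //; exact: ltW.
move=> f mf fairf.
have [B B0 potB] := potential_bounded c0 w_gt0 w_lt1.
(* A competitor may be unbounded, whereas the potential is bounded only over [0, 2c]. Clamping to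
   this interval, which contains the values of [fstar] and [ffair], brings the competitor no further
   from [fstar] and leaves [ffair] unchanged. *)
pose clamp (y : R) := Num.max 0%R (Num.min y (2 * c)%R).
have clamp_bnd y : (0 <= clamp y <= 2 * c)%R.
  by rewrite /clamp le_max lexx/= ge_max ge_min lexx orbT andbT mulr_ge0// ltW.
pose h (x : (R * attribute) * R) : \bar R :=
  (B + potential c w (delta x.1.1) (x.1.2 == ord0) (clamp x.2))%:E.
have h0 x : 0 <= h x.
  rewrite lee_fin; have := potB (delta x.1.1) (x.1.2 == ord0) (clamp x.2) (bd _) (clamp_bnd _).
  by rewrite ler_norml => /andP[+ _]; lra.
have mh : measurable_fun setT h.
  apply/measurable_EFinP; apply: measurable_funD => //.
  have mcl : measurable_fun [set: (R * attribute) * R] (fun x => clamp x.2).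
    by apply: measurable_maxr => //; exact: measurable_minr.
  have mb : measurable_fun [set: (R * attribute) * R]
      (fun x => (clamp x.2 ^+ 2 - 2 * brenier c w (delta x.1.1) (clamp x.2))%R).
    apply: measurable_funB; first exact: measurable_funX.
    apply: measurable_funM => //; apply: measurable_brenier => //.
    exact: measurable_delta11.
  apply: measurable_fun_ifT => //; last exact: measurable_funM.
  by apply: measurable_eq0; exact: (measurableT_comp measurable_snd).
have hB v y : \sum_s h (v, s, y) * ws [set s] = B%:E.
  transitivity (\sum_s ((B + potential c w (delta v) (s == ord0) (clamp y)) * ww s)%:E).
    by apply: eq_bigr => s _; rewrite wsE.
  rewrite sumEFin; congr (_%:E).
  rewrite (bigD1 ord0)//=.
  transitivity ((B + potential c w (delta v) true (clamp y)) * w +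
    (B + potential c w (delta v) false (clamp y)) * (1 - w))%R.
    rewrite wE; congr (_ + _)%R.
    have -> : (1 - ww ord0 = \sum_(s | s != ord0) ww s)%R.
      by rewrite -ww1 (bigD1 ord0)//= addrAC subrr add0r.
    by rewrite mulr_sumr; apply: eq_bigr => s /negbTE ->.
  have := @potential_sum _ c w (delta v) (clamp y) w_gt0.
  by set p := potential _ _ _ true _; set q := potential _ _ _ false _; lra.
(* By [hB], adding the potential to the squared error shifts the risk of every fair
   predictor by the same constant [B]. *)
have meanf := fair_mean mf fairf mh h0 hB.
have meanff := fair_mean (measurable_ffair i0 c w delta) ff mh h0 hB.
have msq (g : covariate -> R) : measurable_fun setT g ->
    measurable_fun [set: observation]
      (fun z => ((g (obsXS z) - fstar i0 c (obsXS z)) ^+ 2)%:E).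
  move=> mg; apply/measurable_EFinP; apply: measurable_funX.
  apply: measurable_funB; first exact: (measurableT_comp mg measurable_obsXS).
  exact: measurable_fstarXS.
have mhg (g : covariate -> R) : measurable_fun setT g ->
    measurable_fun [set: observation] (fun z => h (obsVS z, g (obsXS z))).
  move=> mg; apply: (measurableT_comp mh).
  apply: measurable_fun_pair; first exact: measurable_obsVS.
  exact: (measurableT_comp mg measurable_obsXS).
rewrite /sqdist -(leeD2rE (x := B%:E))//.
(* The two expressions of [B] are placed crosswise, the mean at [f] on the side of [ffair] and
   conversely, to match the shape of [potential_certificate]. *)
rewrite -[X in _ + X <= _]meanf -[X in _ <= _ + X]meanff.
have mff := measurable_ffair i0 c w delta.
rewrite -!ge0_integralD//; try (by move=> z _; rewrite lee_fin sqr_ge0);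
  try exact: msq; try exact: mhg.
apply: le_integral_sample_law => //.
- by apply: emeasurable_funD; [exact: msq|exact: mhg].
- by move=> z; rewrite adde_ge0// lee_fin sqr_ge0.
- by apply: emeasurable_funD; [exact: msq|exact: mhg].
- by move=> z; rewrite adde_ge0// lee_fin sqr_ge0.
move=> vs r r01; rewrite -!EFinD lee_fin.
rewrite obsVS_embed ffair_sample// fstar_sample /=.
set t := regression_value _ _ _; set y0 := bary_quantile _ _ _ _; set y := f _.
have /andP[t0 t1] : (0 <= t <= 2 * c)%R.
  by apply: regression_value_bounds; [exact: ltW|exact: level_bounds].
have /andP[y00 y01] : (0 <= y0 <= 2 * c)%R.
  by apply: bary_quantile_bounds => //; [exact: ltW|rewrite !ltW].
have -> : clamp y0 = y0 by rewrite /clamp (min_idPl y01) (max_idPr y00).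
have tE : t = (if vs.2 == ord0 then lumps c (tilt_quantile (delta vs.1) r) else c * r)%R.
  by rewrite /t /regression_value /level /=; case: (vs.2 == ord0).
have := potential_certificate (clamp y) c0 w_gt0 w_lt1 (bd vs.1) tE (erefl y0).
have : ((clamp y - t) ^+ 2 <= (y - t) ^+ 2)%R.
  rewrite /clamp; case: (leP y (2 * c)%R) => h1; case: (leP 0%R _) => h2; nra.
by lra.
Qed.

Lemma tilt_quantile0 (r : R) : tilt_quantile 0 r = r.
Proof. by rewrite /tilt_quantile subr0 !addr0 !divr1; case: ifP. Qed.

Definition null_tilt : {mfun R >-> R} := cst 0%R.

Lemma level_null vs r : @level R k null_tilt vs r = r.
Proof. by rewrite /level tilt_quantile0; case: ifP. Qed.

(** Conditionally on (V, S), both observations are the image under [embed] of a position, which is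
    uniform for the null tilt and has density [tilt_density] with respect to it in the first
    group. *)
Lemma sample_law_density delta : bounded_tilt delta ->
  density (sample_law delta) (sample_law null_tilt) (sample_density i0 delta).
Proof.
move=> bd A mA; rewrite integral_mkcond integral_sample_law; last 2 first.
- apply/(measurable_restrictT _ _).1 => //; apply: measurable_funTS.
  by apply/measurable_EFinP; exact: measurable_sample_density.
- by move=> z; apply: erestrict_ge0 => ? _; rewrite lee_fin sample_density_ge0.
transitivity (\int[unif \x ws]_vs unif (xsection (sample delta @^-1` A) vs)).
  exact: sample_law_xsection.
apply: eq_integral => -[v s] _.
pose B := [set u : R | A (embed c ((v, s), u))].
have mB : measurable B.
  rewrite -[X in measurable X]setTI.
  have m1 : measurable_fun [set: R] (fun u => @embed R d k c ((v, s), u)).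
    by apply: (measurableT_comp (measurable_embed c)); exact: measurable_pair1.
  exact: m1.
have -> : xsection (sample delta @^-1` A) (v, s) = level delta (v, s) @^-1` B.
  by apply/seteqP; split => r; rewrite /xsection/= inE.
transitivity (\int[unif]_(u in B)
    (if s == ord0 then tilt_density (delta v) u else 1)%:E); last first.
  rewrite integral_mkcond; apply: eq_integral => u _; rewrite !patchE.
  rewrite /sample level_null.
  have -> : (embed c ((v, s), u) \in A) = (u \in B) by apply/idP/idP; rewrite !inE.
  by case: ifP => // _; rewrite /sample_density cov_u_embed.
case: (eqVneq s ord0) => [->|s0]; first exact: (tilt_change_of_variables (bd v) mB).
have -> : level delta (v, s) = id by apply/funext => r; rewrite /level /= (negbTE s0).
transitivity (\int[unif]_(u in B) cst 1 u); last exact: eq_integral.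
by rewrite integral_cst// mul1e.
Qed.

End optimality.

(** * Assouad's argument *)

Section tents.
Context {R : realType} {m : nat}.
Implicit Types (i j : 'I_m) (v l : R) (e : {ffun 'I_m -> bool}).

Definition center j : R := (2 * (j : nat)%:R + 1) / (2 * m%:R).

Definition tent j v : R := Num.max 0 ((2 * m%:R)^-1 - `|v - center j|).

Definition bump l e v : R := \sum_j (-1) ^+ (e j) * (l * tent j v).

Lemma tent_ge0 j v : 0 <= tent j v.
Proof. by rewrite /tent le_max lexx. Qed.

Lemma tent_le j v : tent j v <= (2 * m%:R)^-1.
Proof. by rewrite /tent ge_max invr_ge0 mulr_ge0//= gerBl. Qed.

Lemma tent_dist j v v' : `|tent j v - tent j v'| <= `|v - v'|.
Proof.
rewrite /tent; set a := (2 * m%:R)^-1; set x := `|v - _|; set y := `|v' - _|.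
have xy : `|x - y| <= `|v - v'|.
  rewrite /x /y (le_trans (ler_dist_dist _ _))//.
  by rewrite opprB addrA subrK.
move: xy; rewrite !ler_norml => /andP[h1 h2].
by case: (leP 0 (a - x)) => h3; case: (leP 0 (a - y)) => h4; apply/andP; split; lra.
Qed.

(** Distinct centers are at least 1/m apart. *)
Lemma center_sep i j v : `|v - center i| < (2 * m%:R)^-1 ->
  `|v - center j| < (2 * m%:R)^-1 -> i = j.
Proof.
move=> hi hj; have m0 : 0 < m%:R :> R by rewrite ltr0n (leq_ltn_trans _ (ltn_ord i)).
have : `|center i - center j| < m%:R^-1.
  rewrite (_ : center i - center j = (v - center j) - (v - center i)); last by ring.
  rewrite (le_lt_trans (ler_normB _ _))//.
  by move: hi hj; rewrite invfM => hi hj; lra.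
rewrite /center -mulrBl (_ : _ - _ = 2 * (i%:R - j%:R)); last by ring.
rewrite (_ : _ / _ = (i%:R - j%:R) / m%:R); last by field; rewrite gt_eqF.
rewrite normrM normfV (gtr0_norm m0) ltr_pdivrMr// mulVf ?gt_eqF//.
rewrite ltr_norml => /andP[h1 h2]; apply/val_inj/eqP; rewrite eqn_leq.
have /= : i%:R < j%:R + 1 :> R by lra.
rewrite natr1 ltr_nat ltnS => ->.
have /= : j%:R < i%:R + 1 :> R by lra.
by rewrite natr1 ltr_nat ltnS => ->.
Qed.

Lemma tent_gt0 j v : (0 < tent j v) = (`|v - center j| < (2 * m%:R)^-1).
Proof. by rewrite /tent lt_max ltxx/= subr_gt0. Qed.

Lemma tent_disjoint i j v : 0 < tent j v -> i != j -> tent i v = 0.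
Proof.
move=> tj ij; apply/eqP; rewrite eq_le tent_ge0 andbT leNgt; apply/negP => ti.
by move: ij; rewrite (center_sep (v := v) (i := i) (j := j)) ?eqxx// -tent_gt0.
Qed.

(** Reduces [bump] at [v] to a single term; if no tent is positive there, any index serves. *)
Lemma tent_owner v : (0 < m)%N -> exists j, forall i, i != j -> tent i v = 0.
Proof.
move=> m0; have [[j tj]|none] := pselect (exists j, 0 < tent j v).
  by exists j => i; exact: tent_disjoint.
exists (Ordinal m0) => i _; apply/eqP; rewrite eq_le tent_ge0 andbT leNgt.
by apply/negP => ti; apply: none; exists i.
Qed.

Lemma bump_owner l e v j : (forall i, i != j -> tent i v = 0) ->
  bump l e v = (-1) ^+ (e j) * (l * tent j v).
Proof.
move=> tj; rewrite /bump (bigD1 j)//= big1 ?addr0// => i ij.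
by rewrite tj// !mulr0.
Qed.

Lemma bump_bounded l e v : (0 < m)%N -> 0 <= l <= 1 ->
  -2^-1 <= bump l e v <= 2^-1.
Proof.
move=> m0 /andP[l0 l1]; have [j tj] := tent_owner v m0.
have t1 : l * tent j v <= 2^-1.
  rewrite -[leRHS]mul1r; apply: ler_pM => //; first exact: tent_ge0.
  rewrite (le_trans (tent_le _ _))// lef_pV2 ?posrE ?mulr_gt0 ?ltr0n//.
  by rewrite ler_peMr// ler1n.
have t0 : 0 <= l * tent j v by rewrite mulr_ge0// tent_ge0.
by rewrite (bump_owner l e tj); case: (e j); rewrite ?expr0 ?expr1; lra.
Qed.

(** The factor 2 comes from points with different owners: each of the two tents vanishes at the
    other point, so each term is at most [l * |v - v'|]. *)
Lemma bump_lipschitz l e v v' : (0 < m)%N -> 0 <= l ->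
  `|bump l e v - bump l e v'| <= 2 * l * `|v - v'|.
Proof.
move=> m0 l0; have [j tj] := tent_owner v m0; have [j' tj'] := tent_owner v' m0.
have lv : 0 <= l * `|v - v'| by exact: mulr_ge0.
rewrite (bump_owner l e tj) (bump_owner l e tj').
have sg (b : bool) (x : R) : `|(-1) ^+ b * x| = `|x| by rewrite normrM normr_sign mul1r.
case: (eqVneq j j') => [<-|jj'].
  rewrite -mulrBr sg -mulrBr normrM (ger0_norm l0).
  by have := ler_wpM2l l0 (tent_dist j v v'); lra.
rewrite (le_trans (ler_normB _ _))// !sg !normrM (ger0_norm l0).
have := ler_wpM2l l0 (tent_dist j v v'); rewrite (tj' j jj') subr0.
have := ler_wpM2l l0 (tent_dist j' v v'); rewrite (tj j') 1?eq_sym// sub0r normrN.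
by lra.
Qed.

Lemma measurable_tent j : measurable_fun [set: R] (tent j).
Proof.
apply: measurable_maxr => //; apply: measurable_funB => //.
by apply: measurableT_comp => //; exact: measurable_funB.
Qed.

Lemma measurable_bump l e : measurable_fun [set: R] (bump l e).
Proof.
apply: measurable_sum => j; apply: measurable_funM => //.
by apply: measurable_funM => //; exact: measurable_tent.
Qed.

HB.instance Definition _ l e :=
  isMeasurableFun.Build _ _ _ _ (bump l e) (measurable_bump l e).

Definition flip j e : {ffun 'I_m -> bool} := [ffun i => (i == j) (+) e i].

Lemma flipK j : involutive (flip j).
Proof. by move=> e; apply/ffunP => i; rewrite !ffunE addbA addbb. Qed.

Lemma bump_flip l e j v : 0 < tent j v -> bump l (flip j e) v = - bump l e v.
Proof.
move=> tj; have o i := @tent_disjoint i j v tj.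
rewrite !(bump_owner l _ o) ffunE eqxx /=.
by case: (e j); rewrite ?expr0 ?expr1; ring.
Qed.

Lemma bump_flip0 l e j v : tent j v = 0 -> bump l (flip j e) v = bump l e v.
Proof.
move=> tj; apply: eq_bigr => i _; rewrite ffunE.
by case: (eqVneq i j) => [->|]//; rewrite tj !mulr0.
Qed.

Lemma bump_sqr l e j v : 0 < tent j v -> bump l e v ^+ 2 = (l * tent j v) ^+ 2.
Proof.
move=> tj; have o i := @tent_disjoint i j v tj.
by rewrite (bump_owner l e o) exprMn sqrr_sign mul1r.
Qed.

End tents.

(** The worst case dominates the average over all sign vectors. For each [j] the involution [flip j]
    leaves the sum over [e] unchanged, so twice the total of all [r j e] is at least 2^m m D, while
    the total is at most 2^m W. *)
Lemma assouad_average {R : realType} {m : nat} (W : \bar R)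
    (r : 'I_m -> {ffun 'I_m -> bool} -> \bar R) (D : R) :
  (forall j e, 0 <= r j e)%E -> (forall e, \sum_j r j e <= W)%E ->
  (forall j e, D%:E <= r j e + r j (flip j e))%E ->
  ((m%:R * D / 2)%:E <= W)%E.
Proof.
move=> r0 rW rD.
have W0 : (0 <= W)%E.
  by apply: le_trans (rW [ffun=> false]); apply: sume_ge0 => j _.
case: W W0 rW => [W||]// W0 rW; last by rewrite leey.
pose S := (\sum_e \sum_j r j e)%E.
pose T := #|{ffun 'I_m -> bool}|%:R : R.
have T0 : 0 < T by rewrite ltr0n card_ffun card_bool expn_gt0.
have SW : (S <= (T * W)%:E)%E.
  apply: (@le_trans _ _ (\sum_(e : {ffun 'I_m -> bool}) W%:E)%E).
    by apply: lee_sum => e _.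
  by rewrite sumEFin sumr_const -mulr_natl.
have SD : ((T * (m%:R * D))%:E <= S + S)%E.
  have -> : (S + S = \sum_j \sum_e (r j e + r j (flip j e)))%E.
    have E j : (\sum_e r j (flip j e) = \sum_e r j e)%E.
      by rewrite [RHS](reindex_inj (inv_inj (@flipK m j))).
    rewrite [RHS](eq_bigr (fun j => \sum_e r j e + \sum_e r j e)%E).
      by rewrite big_split /= /S exchange_big.
    by move=> j _; rewrite big_split /= E.
  apply: (@le_trans _ _ (\sum_(j < m) \sum_(e : {ffun 'I_m -> bool}) D%:E)%E).
    rewrite (eq_bigr (fun=> (T * D)%:E)); last first.
      by move=> j _; rewrite sumEFin sumr_const -mulr_natl.
    by rewrite sumEFin sumr_const card_ord -mulr_natl lee_fin; lra.
  by apply: lee_sum => j _; apply: lee_sum => e _.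
have := le_trans SD (leeD SW SW); rewrite -EFinD !lee_fin => h.
rewrite ler_pdivrMr// -(ler_pM2l T0); lra.
Qed.

(** * The loss and the information carried by one cell *)

Section lower_bound.
Context {R : realType} {d k m : nat}.
Local Notation attribute := 'I_k.+2.
Local Notation covariate := (d.-tuple R * attribute)%type.
Local Notation observation := (d.-tuple R * R * attribute * R)%type.
Local Notation unif := (@unif01 R).

(** For levels between (1 - b)/2 and (1 + b)/2, the quantile with tilt [b] is past its jump and the
    one with tilt [- b] still before it. Beyond the jump [c * w], the difference only gains c w b /
    (1 + b). *)
Lemma bary_quantile_gap (c w b r : R) : 0 <= c -> 0 <= w -> 0 <= b <= 2^-1 ->
  (1 - b) / 2 < r < (1 + b) / 2 ->
  c * w <= bary_quantile c w b r - bary_quantile c w (- b) r.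
Proof.
move=> c0 w0 /andP[b0 b1] /andP[r0 r1].
have tb : -2^-1 <= b <= 2^-1 by apply/andP; split; lra.
have tnb : -2^-1 <= - b <= 2^-1 by apply/andP; split; lra.
rewrite /bary_quantile /lumps !tilt_quantile_lt// opprK r1 ltNge (ltW r0) /=.
rewrite /tilt_quantile opprK r1 ltNge (ltW r0) /=.
set X := (X in _ <= X).
have -> : X = c * w + c * w * (b / (1 + b)) by rewrite /X; field; lra.
by rewrite lerDl !mulr_ge0// invr_ge0; lra.
Qed.

Variables (i0 : 'I_d) (c w l : R) (ws : probability attribute R).
Implicit Types (e : {ffun 'I_m -> bool}) (j : 'I_m) (z : observation).
Local Notation sample_law := (@sample_law R d k c ws).
Local Notation Q := (sample_law null_tilt).
Local Notation p := (fun e => sample_density i0 (bump l e)).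

(** The first group is left out because the other groups have density 1 under every tilt, and [v] is
    kept to the middle half of the cell because there the tent is at least 1/(4m). *)
Definition cell j z : R :=
  if (obsS z != ord0) && (`|obsV z - center j| <= (4 * m%:R)^-1) then 1 else 0.

Definition cell_fair e z : R := ffair i0 c w (bump l e) (obsXS z).

(* A lower bound for the geometric mean of the two densities, which differ only on the
   first group and by [2 * l * tent j]; there [sqrt (1 - x ^+ 2) >= 1 - x ^+ 2]. *)
Definition overlap e j z : R :=
  (p e z + p (flip j e) z) / 2 -
  (if obsS z == ord0 then (l * tent j (obsV z)) ^+ 2 else 0).

Lemma cell_ge0 j z : 0 <= cell j z.
Proof. by rewrite /cell; case: ifP. Qed.

Lemma cell_tent j (v : R) : `|v - center j| <= (4 * m%:R)^-1 ->
  (4 * m%:R)^-1 <= tent j v.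
Proof.
have m0 : 0 < m%:R :> R by rewrite ltr0n (leq_ltn_trans _ (ltn_ord j)).
move=> h; rewrite /tent le_max; apply/orP; right.
by move: h; rewrite !invfM; lra.
Qed.

Lemma cell_tent_gt0 j (v : R) : `|v - center j| <= (4 * m%:R)^-1 -> 0 < tent j v.
Proof.
move=> /cell_tent; apply: lt_le_trans.
by rewrite invr_gt0 mulr_gt0// ltr0n (leq_ltn_trans _ (ltn_ord j)).
Qed.

Lemma measurable_cell j : measurable_fun [set: observation] (cell j).
Proof.
apply: measurable_fun_ifT => //; apply: measurable_and.
  apply: (measurableT_comp (f := negb)) => //.
  by apply: measurable_eq0; exact: measurable_obsS.
apply: measurable_fun_ler => //; apply: measurableT_comp => //.
by apply: measurable_funB => //; exact: measurable_obsV.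
Qed.

Lemma measurable_overlap e j : measurable_fun [set: observation] (overlap e j).
Proof.
apply: measurable_funB.
  by apply: measurable_funM => //; apply: measurable_funD; exact: measurable_sample_density.
apply: measurable_fun_ifT => //; first by apply: measurable_eq0; exact: measurable_obsS.
apply: measurable_funX; apply: measurable_funM => //.
exact: (measurableT_comp (measurable_tent j) measurable_obsV).
Qed.

Section hypotheses_on_the_model.
Hypotheses (m_gt0 : (0 < m)%N) (l_bnd : 0 <= l <= 1).

Lemma bounded_bump e : bounded_tilt (bump l e).
Proof. by move=> v; exact: bump_bounded. Qed.

(** The cells are disjoint and lie where the density is 1; this is what lets the losses of all the
    cells be bounded by a single risk. *)
Lemma sum_cell_le e z : \sum_j cell j z <= p e z.
Proof.
rewrite /cell; case: (eqVneq (obsS z) ord0) => [s0|s0] /=.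
  by rewrite big1// sample_density_ge0//; exact: bounded_bump.
rewrite /sample_density (negbTE s0).
have [j tj] := tent_owner (obsV z) m_gt0.
rewrite (bigD1 j)//= big1 ?addr0; first by case: ifP.
by move=> i ij; case: ifP => // /cell_tent_gt0; rewrite tj// ltxx.
Qed.

Lemma integral_sample_density e : (\int[Q]_z (p e z)%:E = 1)%E.
Proof.
rewrite -(sample_law_density i0 c ws (@bounded_bump e) measurableT).
exact: probability_setT.
Qed.

(** In the first group, where the tent is positive, the densities are 1 - b and 1 + b in some order
    and [overlap] equals their product 1 - b^2, which is at most 1 and so dominates its own square.
    Elsewhere the two densities coincide. *)
Lemma overlap_spec e j z :
  0 <= overlap e j z /\ overlap e j z ^+ 2 <= p e z * p (flip j e) z.
Proof.
rewrite /overlap /sample_density; case: (obsS z == ord0); last first.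
  by rewrite (_ : (1 + 1) / 2 - 0 = 1 :> R) ?expr1n ?mulr1//; field.
rewrite /=; set v := obsV z; set u := cov_u _ _.
have := tent_ge0 j v; rewrite le_eqVlt => /orP[/eqP t0|t0].
  rewrite bump_flip0// -t0 mulr0 expr0n/= subr0.
  rewrite (_ : (_ + _) / 2 = tilt_density (bump l e v) u); last by field.
  rewrite expr2 lexx; split=> //; rewrite /tilt_density.
  by have /= /andP[b1 b2] := bounded_bump e v; case: ifP => _; lra.
rewrite bump_flip// -(bump_sqr l e t0); set b := bump l e v.
have /= /andP[b1 b2] := bounded_bump e v; rewrite -/b in b1 b2.
have bb : b ^+ 2 <= 1 by nra.
rewrite /tilt_density; case: ifP => _.
  rewrite (_ : (1 - b + (1 - - b)) / 2 = 1); last by field.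
  by split; nra.
rewrite (_ : (1 + b + (1 - b)) / 2 = 1); last by field.
by split; nra.
Qed.

Lemma unif01_le_lebesgue (A : set R) : measurable A ->
  (unif A <= @lebesgue_measure R A)%E.
Proof.
move=> mA; rewrite unif01_lebesgue//; apply: le_measure; rewrite ?inE//.
exact: measurableI.
Qed.

Lemma sample_law_obsV delta (A : set R) : measurable A ->
  sample_law delta (@obsV R d k @^-1` A) = unif A.
Proof.
move=> mA; rewrite -(mule1 (unif A)) -(probability_setT ws) -product_measure1E//.
rewrite -(@sample_law_obsVS R d k c ws delta); last exact: measurableX.
by congr (sample_law delta _); apply/seteqP; split => z //= [].
Qed.

(** The mean of the two densities integrates to 1. The correction is at most (l/(2m))^2, and
    vanishes unless V is in an interval of length 1/m. *)
Lemma integral_overlap e j :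
  ((1 - l ^+ 2 / (4 * m%:R ^+ 3))%:E <= \int[Q]_z (overlap e j z)%:E)%E.
Proof.
have m0 : 0 < m%:R :> R by rewrite ltr0n.
pose q z : R := if obsS z == ord0 then (l * tent j (obsV z)) ^+ 2 else 0.
have mt : measurable_fun [set: observation] (fun z => tent j (obsV z)).
  exact: (measurableT_comp (measurable_tent j) measurable_obsV).
have mq : measurable_fun [set: observation] q.
  apply: measurable_fun_ifT => //; first by apply: measurable_eq0; exact: measurable_obsS.
  by apply: measurable_funX; exact: measurable_funM.
have q0 z : 0 <= q z by rewrite /q; case: ifP => // _; exact: sqr_ge0.
have g0 z : 0 <= overlap e j z by have [] := overlap_spec e j z.
have mg := measurable_overlap e j.
have mp e' : measurable_fun [set: observation] (EFin \o p e').
  by apply/measurable_EFinP; exact: measurable_sample_density.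
have p0 e' z : 0 <= p e' z by apply: sample_density_ge0; exact: bounded_bump.
have sum1 : (\int[Q]_z (overlap e j z)%:E + \int[Q]_z (q z)%:E = 1)%E.
  rewrite -ge0_integralD//; last 4 first.
  - by move=> z _; rewrite lee_fin.
  - exact/measurable_EFinP.
  - by move=> z _; rewrite lee_fin.
  - exact/measurable_EFinP.
  transitivity (\int[Q]_z (2^-1%:E * ((p e z)%:E + (p (flip j e) z)%:E)))%E.
    apply: eq_integral => z _; rewrite -!EFinD -EFinM; congr (_%:E).
    by rewrite /overlap -/(q z); lra.
  rewrite ge0_integralZl//; last 2 first.
  - exact: emeasurable_funD (mp e) (mp (flip j e)).
  - by move=> z _; rewrite adde_ge0// lee_fin.
  rewrite ge0_integralD//; try (by move=> z _; rewrite lee_fin); try exact: mp.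
  rewrite !integral_sample_density -EFinD -EFinM.
  by congr (_%:E); field.
pose I : set R := [set` `[center j - (2 * m%:R)^-1, center j + (2 * m%:R)^-1]].
have mI : measurable (@obsV R d k @^-1` I).
  by rewrite -[X in measurable X]setTI; exact: (measurable_obsV measurableT (measurable_itv _)).
have qle : (\int[Q]_z (q z)%:E <= (l ^+ 2 / (4 * m%:R ^+ 3))%:E)%E.
  apply: (@le_trans _ _
      (\int[Q]_z ((l * (2 * m%:R)^-1) ^+ 2 * \1_(@obsV R d k @^-1` I) z)%:E)%E).
    apply: ge0_le_integral => //.
    - by move=> z _; rewrite lee_fin.
    - exact/measurable_EFinP.
    - by apply/measurable_EFinP; apply: measurable_funM.
    - move=> z _; rewrite lee_fin /q.
      case: ifP => _; last by rewrite mulr_ge0 ?sqr_ge0// indicE.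
      have t0 := tent_ge0 j (obsV z); have t1 := tent_le j (obsV z).
      case/andP: l_bnd => l0 _.
      move: t0; rewrite le_eqVlt => /orP[/eqP <-|t0].
        by rewrite mulr0 expr0n/= mulr_ge0 ?sqr_ge0// indicE.
      rewrite indicE mem_set; last first.
        rewrite /I /= in_itv/=; move: t0; rewrite tent_gt0 ltr_norml => /andP[h1 h2].
        by apply/andP; split; lra.
      have h1 : 0 <= l * tent j (obsV z) by rewrite mulr_ge0// ltW.
      have h2 : l * tent j (obsV z) <= l * (2 * m%:R)^-1 by exact: ler_wpM2l.
      by rewrite mulr1 ler_pXn2r// nnegrE// (le_trans h1).
  have mIE : measurable_fun [set: observation]
      (fun z => (\1_(@obsV R d k @^-1` I) z : R)%:E).
    by apply/measurable_EFinP; exact: measurable_indic.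
  under eq_integral do rewrite EFinM.
  rewrite ge0_integralZl//; last by rewrite lee_fin sqr_ge0.
  have -> : (\int[Q]_z (\1_(@obsV R d k @^-1` I) z)%:E = unif I)%E.
    by rewrite integral_indic// setIT; exact: (@sample_law_obsV null_tilt I (measurable_itv _)).
  apply: (@le_trans _ _ (((l * (2 * m%:R)^-1) ^+ 2)%:E * (m%:R^-1)%:E)%E).
    apply: lee_wpmul2l; first by rewrite lee_fin sqr_ge0.
    apply: (@le_trans _ _ (lebesgue_measure I)).
      exact: (unif01_le_lebesgue (measurable_itv _)).
    rewrite /I lebesgue_measure_itv/=.
    case: ifP => _; last by rewrite lee_fin invr_ge0.
    by rewrite -EFinB lee_fin invfM; lra.
  by rewrite -EFinM lee_fin le_eqVlt; apply/orP; left; apply/eqP; field; rewrite gt_eqF.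
move: sum1 qle; have : (0 <= \int[Q]_z (q z)%:E)%E by apply: integral_ge0 => z _; rewrite lee_fin.
case: (\int[Q]_z (q z)%:E)%E => [b||]//.
case: (\int[Q]_z (overlap e j z)%:E)%E => [a||]// _ [ab].
by rewrite !lee_fin; lra.
Qed.

Definition cell_loss n (fhat : n.-tuple observation -> covariate -> R) e j
    (D : n.-tuple observation) : \bar R :=
  (\int[Q]_z ((fhat D (obsXS z) - cell_fair e z) ^+ 2 * cell j z)%:E)%E.

Lemma measurable_cell_fair e : measurable_fun [set: observation] (cell_fair e).
Proof. exact: measurable_ffairXS. Qed.

Lemma measurable_sqerror n (fhat : n.-tuple observation -> covariate -> R) e
    (q : observation -> R) :
  estimator fhat -> measurable_fun setT q ->
  measurable_fun [set: n.-tuple observation * observation]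
    (fun u => ((fhat u.1 (obsXS u.2) - cell_fair e u.2) ^+ 2 * q u.2)%:E).
Proof.
move=> est mq; apply/measurable_EFinP; apply: measurable_funM; last first.
  exact: (measurableT_comp mq measurable_snd).
apply: measurable_funX; apply: measurable_funB; last first.
  exact: (measurableT_comp (measurable_cell_fair e) measurable_snd).
have mpair : measurable_fun [set: n.-tuple observation * observation]
    (fun u => (u.1, obsXS u.2)).
  apply: measurable_fun_pair => //.
  exact: (measurableT_comp measurable_obsXS measurable_snd).
exact: (measurableT_comp est mpair).
Qed.

Lemma measurable_cell_loss n (fhat : n.-tuple observation -> covariate -> R) e j :
  estimator fhat -> measurable_fun setT (cell_loss fhat e j).
Proof.
move=> est.
apply: (@measurable_fun_fubini_tonelli_F _ _ _ _ _ Q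
  (fun u : n.-tuple observation * observation =>
    ((fhat u.1 (obsXS u.2) - cell_fair e u.2) ^+ 2 * cell j u.2)%:E)).
  by apply: measurable_sqerror => //; exact: measurable_cell.
by move=> u; rewrite lee_fin mulr_ge0 ?sqr_ge0// cell_ge0.
Qed.

Lemma cell_loss_ge0 n (fhat : n.-tuple observation -> covariate -> R) e j D :
  (0 <= cell_loss fhat e j D)%E.
Proof. by apply: integral_ge0 => z _; rewrite lee_fin mulr_ge0 ?sqr_ge0// cell_ge0. Qed.

(** Both the sample and the fresh observation are moved to the reference law; the density of the
    fresh one is then bounded below by the sum of the cells. *)
Lemma cell_risk_le n (fhat : n.-tuple observation -> covariate -> R) e :
  estimator fhat ->
  (\sum_j \int[iid_law Q n]_D (cell_loss fhat e j D * (likelihood (p e) D)%:E) <=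
   risk fhat (sample_law (bump l e)) (ffair i0 c w (bump l e)))%E.
Proof.
move=> est.
have p0 z : 0 <= p e z by apply: sample_density_ge0; exact: bounded_bump.
have mp : measurable_fun [set: observation] (p e) by exact: measurable_sample_density.
have dens := sample_law_density i0 c ws (@bounded_bump e).
have sqE D : sqdist (sample_law (bump l e)) (fhat D) (ffair i0 c w (bump l e)) =
    (\int[Q]_z ((fhat D (obsXS z) - cell_fair e z) ^+ 2 * p e z)%:E)%E.
  rewrite /sqdist (ge0_integral_density mp p0 dens)//.
    have := @measurable_sqerror n fhat e (cst 1) est (measurable_cst _).
    move=> /(measurableT_comp)/(_ (measurable_pair1 D)).
    by apply: eq_measurable_fun => z _ /=; rewrite mulr1.
  by move=> z; rewrite lee_fin sqr_ge0.
have msq : measurable_fun [set: n.-tuple observation] (fun D =>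
    \int[Q]_z ((fhat D (obsXS z) - cell_fair e z) ^+ 2 * p e z)%:E)%E.
  apply: (@measurable_fun_fubini_tonelli_F _ _ _ _ _ Q
    (fun u : n.-tuple observation * observation =>
      ((fhat u.1 (obsXS u.2) - cell_fair e u.2) ^+ 2 * p e u.2)%:E)).
    exact: measurable_sqerror.
  by move=> u; rewrite lee_fin mulr_ge0 ?sqr_ge0.
have sq0 D : (0 <= \int[Q]_z ((fhat D (obsXS z) - cell_fair e z) ^+ 2 * p e z)%:E)%E.
  by apply: integral_ge0 => z _; rewrite lee_fin mulr_ge0 ?sqr_ge0.
have mL : measurable_fun [set: n.-tuple observation] (EFin \o likelihood (p e) (n := n)).
  by apply/measurable_EFinP; exact: measurable_likelihood.
have L0 (D : n.-tuple observation) : (0 <= (likelihood (p e) D)%:E)%E.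
  by rewrite lee_fin likelihood_ge0.
rewrite /risk; under [leRHS]eq_integral do rewrite sqE.
rewrite (iid_law_density mp p0 dens)// -ge0_integral_sum//; last 2 first.
- by move=> j; apply: emeasurable_funM => //; exact: measurable_cell_loss.
- by move=> j D _; rewrite mule_ge0// cell_loss_ge0.
apply: ge0_le_integral => //.
- by move=> D _; apply: sume_ge0 => j _; rewrite mule_ge0// cell_loss_ge0.
- by apply: emeasurable_sum => j; apply: emeasurable_funM => //; exact: measurable_cell_loss.
- exact: emeasurable_funM.
move=> D _; rewrite -ge0_sume_distrl; last by move=> j _; exact: cell_loss_ge0.
apply: lee_wpmul2r => //.
have mDq (q : observation -> R) : measurable_fun setT q ->
    measurable_fun [set: observation]
      (fun z => ((fhat D (obsXS z) - cell_fair e z) ^+ 2 * q z)%:E).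
  by move=> mq; exact: (measurableT_comp (measurable_sqerror e est mq) (measurable_pair1 D)).
rewrite /cell_loss -ge0_integral_sum//; last 2 first.
- by move=> j; apply: mDq; exact: measurable_cell.
- by move=> j z _; rewrite lee_fin mulr_ge0 ?sqr_ge0// cell_ge0.
apply: ge0_le_integral => //.
- by move=> z _; apply: sume_ge0 => j _; rewrite lee_fin mulr_ge0 ?sqr_ge0// cell_ge0.
- by apply: emeasurable_sum => j; apply: mDq; exact: measurable_cell.
- exact: mDq.
- move=> z _; rewrite sumEFin lee_fin -mulr_sumr ler_wpM2l ?sqr_ge0//.
  exact: sum_cell_le.
Qed.

End hypotheses_on_the_model.
End lower_bound.

Section cell_separation.
Context {R : realType} {d k m : nat}.
Local Notation attribute := 'I_k.+2.
Local Notation covariate := (d.-tuple R * attribute)%type.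
Local Notation observation := (d.-tuple R * R * attribute * R)%type.
Local Notation unif := (@unif01 R).

Lemma unif01_itv (x y : R) (b1 b2 : bool) : 0 <= x -> x <= y -> y <= 1 ->
  (unif [set` Interval (BSide b1 x) (BSide b2 y)] = (y - x)%:E)%E.
Proof.
move=> x0 xy y1; rewrite unif01_lebesgue// setIidl.
  rewrite lebesgue_measure_itv/= lte_fin.
  move: xy; rewrite le_eqVlt => /orP[/eqP ->|->]; last by rewrite EFinB.
  by rewrite ltxx subrr.
move=> z /=; rewrite !itv_boundlr => /andP[h1 h2]; apply/andP; split.
  by apply: le_trans h1; rewrite bnd_simp.
by apply: (le_trans h2); case: b2 {h2}; rewrite bnd_simp.
Qed.

Variables (i0 : 'I_d) (ws : probability attribute R).

(** In the constant, 1/(2m) is the length of the middle half of the cell, 1 - w the mass of the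
    untilted groups, and l/(4m) the width of a window of levels lying between the jumps for both
    signs. There (x - y1)^2 + (x - y2)^2 >= (y1 - y2)^2 / 2 >= (c w)^2 / 2 for any prediction x. *)
Lemma cell_loss_pair n (c w l : R) (fhat : n.-tuple observation -> covariate -> R)
    (e : {ffun 'I_m -> bool}) (j : 'I_m) (D : n.-tuple observation) :
  (0 < m)%N -> 0 < l <= 1 -> 0 <= c -> 0 <= w -> ws [set ord0] = w%:E ->
  estimator fhat ->
  (((c * w) ^+ 2 / 2 * ((2 * m%:R)^-1 * (1 - w) * (l / (4 * m%:R))))%:E <=
   cell_loss i0 c w l ws fhat e j D + cell_loss i0 c w l ws fhat (flip j e) j D)%E.
Proof.
move=> m_gt0 /andP[l0 l1] c0 w0 wsw est.
have l01 : 0 <= l <= 1 by rewrite ltW.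
have m0 : 0 < m%:R :> R by rewrite ltr0n.
have m1 : 1 <= m%:R :> R by rewrite ler1n.
pose Q := sample_law c ws null_tilt : probability observation R.
(* The least size of the tilt over the middle half of the cell; with it the window [W] of levels no
   longer depends on [v]. *)
pose b0 := l / (4 * m%:R).
have b0_ge0 : 0 <= b0 by rewrite divr_ge0 ?mulr_ge0// ltW.
have b0_le : b0 <= 4^-1.
  by rewrite ler_pdivrMr ?mulr_gt0// mulrA mulVf// mul1r (le_trans l1).
pose B : set R := [set` `[center j - (4 * m%:R)^-1, center j + (4 * m%:R)^-1]].
pose S : set attribute := ~` [set ord0].
pose W : set R := [set` `](1 - b0) / 2, (1 + b0) / 2[].
pose G : set observation :=
  [set z | (B (obsV z) /\ S (obsS z)) /\ W (cov_u i0 (obsXS z))].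
have mG : measurable G.
  apply: measurableI; first apply: measurableI.
  - by rewrite -[X in measurable X]setTI; exact: (measurable_obsV measurableT (measurable_itv _)).
  - by rewrite -[X in measurable X]setTI; exact: measurable_obsS.
  - rewrite -[X in measurable X]setTI.
    exact: (measurableT_comp (measurable_cov_u i0) measurable_obsXS measurableT (measurable_itv _)).
have QG : (Q G = ((2 * m%:R)^-1 * (1 - w) * b0)%:E)%E.
  rewrite /Q sample_lawE.
  rewrite (_ : _ @^-1` _ = (B `*` S) `*` W); last first.
    by apply/seteqP; split => -[[v s] r]; rewrite /G /= cov_u_embed /= level_null.
  have mB : measurable B by exact: measurable_itv.
  have mSs : measurable S by [].
  have mW : measurable W by exact: measurable_itv.
  have mBS : measurable (B `*` S) by exact: measurableX.
  transitivity (unif B * ws S * unif W)%E.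
    transitivity ((unif \x ws)%E (B `*` S) * unif W)%E.
      exact: product_measure1E.
    by congr (_ * _)%E; exact: product_measure1E.
  rewrite EFinM EFinM; congr (_ * _ * _)%E.
  - rewrite unif01_itv.
    + by congr (_%:E); field; rewrite gt_eqF.
    + rewrite /center subr_ge0 ler_pdivlMr ?mulr_gt0//.
      rewrite (_ : (4 * m%:R)^-1 * _ = 2^-1); last by field; rewrite gt_eqF.
      by have : 0 <= j%:R :> R by []; lra.
    + by rewrite lerD2l (@le_trans _ _ 0) ?oppr_le0 ?invr_ge0 ?mulr_ge0// ltW.
    + have jm : j%:R + 1 <= m%:R :> R by rewrite natr1 ler_nat.
      rewrite (_ : center j + _ = (2 * j%:R + 1 + 2^-1) / (2 * m%:R)).
        by rewrite ler_pdivrMr ?mulr_gt0//; lra.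
      by rewrite /center; field; rewrite gt_eqF.
  - by rewrite probability_setC// wsw.
  - by rewrite unif01_itv; [congr (_%:E); field|lra|lra|lra].
have mD : measurable_fun [set: observation] (fun z => fhat D (obsXS z)).
  apply: (measurableT_comp (f := fhat D)); last exact: measurable_obsXS.
  exact: (measurableT_comp est (measurable_pair1 D)).
have mS e' : measurable_fun [set: observation]
    (fun z => ((fhat D (obsXS z) - cell_fair i0 c w l e' z) ^+ 2 * cell j z)%:E).
  apply/measurable_EFinP; apply: measurable_funM; last exact: measurable_cell.
  by apply: measurable_funX; apply: measurable_funB => //; exact: measurable_cell_fair.
have S0 e' (z : observation) : (0 <=
    ((fhat D (obsXS z) - cell_fair i0 c w l e' z) ^+ 2 * cell j z)%:E)%E.
  by rewrite lee_fin mulr_ge0 ?sqr_ge0// cell_ge0.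
rewrite /cell_loss -ge0_integralD//.
have -> : (((c * w) ^+ 2 / 2 * ((2 * m%:R)^-1 * (1 - w) * (l / (4 * m%:R))))%:E =
    \int[Q]_z ((c * w) ^+ 2 / 2 * \1_G z)%:E)%E.
  have mIG : measurable_fun [set: observation] (fun z => (\1_G z : R)%:E).
    by apply/measurable_EFinP; exact: measurable_indic.
  under eq_integral do rewrite EFinM.
  rewrite ge0_integralZl//; last by rewrite lee_fin divr_ge0 ?sqr_ge0.
  rewrite EFinM -QG; congr (_ * _)%E.
  by rewrite integral_indic// setIT.
apply: le_integral_sample_law.
- by apply/measurable_EFinP; exact: measurable_funM.
- by move=> z; rewrite lee_fin mulr_ge0 ?divr_ge0 ?sqr_ge0// indicE.
- by apply: emeasurable_funD.
- by move=> z; apply: adde_ge0.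
move=> vs r _; set z := sample _ _ _; rewrite -EFinD lee_fin indicE.
have [/set_mem Gz|_] := boolP (z \in G); last first.
  by rewrite mulr0 addr_ge0// mulr_ge0 ?sqr_ge0// cell_ge0.
have [[Bz Sz] Wz] := Gz.
have vz : obsV z = vs.1 by [].
have sz : obsS z = vs.2 by [].
have uz : cov_u i0 (obsXS z) = r by rewrite cov_u_embed /= level_null.
rewrite uz in Wz; rewrite sz in Sz; rewrite vz in Bz.
have Vz : `|vs.1 - center j| <= (4 * m%:R)^-1.
  by move: Bz; rewrite /B /= in_itv/= ler_norml => /andP[h1 h2]; apply/andP; split; lra.
have sz0 : (vs.2 == ord0) = false by apply/negbTE/eqP.
have cz : cell j z = 1 by rewrite /cell vz sz sz0 Vz.
have fz e' : cell_fair i0 c w l e' z = bary_quantile c w (bump l e' vs.1) r.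
  by rewrite /cell_fair /ffair cov_v_embed uz (_ : (obsXS z).2 = vs.2)// sz0.
rewrite cz !mulr1 !fz bump_flip ?cell_tent_gt0//.
set b := bump l e vs.1.
have bB : -2^-1 <= b <= 2^-1 by exact: bump_bounded.
have b2 : b ^+ 2 = (l * tent j vs.1) ^+ 2 by apply: bump_sqr; exact: cell_tent_gt0.
have b0b : b0 <= l * tent j vs.1.
  by rewrite /b0 ler_wpM2l ?cell_tent// ltW.
have bb : b0 <= `|b|.
  rewrite (le_trans b0b)//; move/eqP: b2; rewrite eqf_sqr => /orP[]/eqP ->.
    exact: ler_norm.
  by rewrite normrN; exact: ler_norm.
have gap : (c * w) ^+ 2 <= (bary_quantile c w b r - bary_quantile c w (- b) r) ^+ 2.
  have /andP[r0 r1] : (1 - b0) / 2 < r < (1 + b0) / 2 by move: Wz; rewrite /W /= in_itv.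
  have cw0 : 0 <= c * w by exact: mulr_ge0.
  have nb : 0 <= `|b| <= 2^-1 by rewrite normr_ge0 ler_norml.
  have rb : (1 - `|b|) / 2 < r < (1 + `|b|) / 2 by apply/andP; split; lra.
  have := bary_quantile_gap c0 w0 nb rb.
  case: (ger0P b) => hb h; first by rewrite !expr2 ler_pM.
  by rewrite opprK in h; rewrite -[leRHS]sqrrN opprB !expr2 ler_pM.
set x := fhat D _; set y1 := bary_quantile _ _ b _ in gap *.
set y2 := bary_quantile _ _ (- b) _ in gap *.
have := sqr_ge0 ((x - y1) + (x - y2)); nra.
Qed.

End cell_separation.

Lemma worst_risk_ge (R : realType) (d k m n : nat) (i0 : 'I_d)
    (ws : probability 'I_k.+2 R) (w : 'I_k.+2 -> R) (c l L : R)
    (fhat : n.-tuple (d.-tuple R * R * 'I_k.+2 * R) ->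
            d.-tuple R * 'I_k.+2 -> R) :
  (forall s, ws [set s] = (w s)%:E) -> (forall s, 0 < w s) ->
  \sum_s w s = 1 -> w ord0 < 1 -> 0 < c -> 0 < l <= 1 -> 2 * l <= L ->
  (0 < m)%N -> (n <= m ^ 3)%N -> estimator fhat ->
  (((c * w ord0) ^+ 2 * (1 - w ord0) * l / (128 * m%:R))%:E <=
   worst_risk w (2 * c) L fhat)%E.
Proof.
move=> wsw w_gt0 w_sum1 w_lt1 c_gt0 /andP[l_gt0 l_le1] lL m_gt0 nm est.
have l01 : 0 <= l <= 1 by rewrite ltW.
have m0 : 0 < m%:R :> R by rewrite ltr0n.
have L_ge0 : 0 <= L by lra.
have w0 : 0 <= w ord0 by exact: ltW.
have c0 : 0 <= c by exact: ltW.
pose D := (c * w ord0) ^+ 2 / 2 * ((2 * m%:R)^-1 * (1 - w ord0) * (l / (4 * m%:R))).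
have D_ge0 : 0 <= D.
  rewrite /D mulr_ge0 ?divr_ge0 ?sqr_ge0// !mulr_ge0 ?divr_ge0 ?invr_ge0 ?mulr_ge0//.
    by rewrite subr_ge0 ltW.
  exact: ltW.
(* [D] carries a factor 1/(16 m^2), the two-point bound costs 4 and the averaging 2: 16 * 4 * 2 =
   128. *)
have -> : (c * w ord0) ^+ 2 * (1 - w ord0) * l / (128 * m%:R) = m%:R * (D / 4) / 2.
  by rewrite /D; field; rewrite gt_eqF.
pose p (e : {ffun 'I_m -> bool}) := sample_density i0 (bump l e) (k := k).
pose r (j : 'I_m) (e : {ffun 'I_m -> bool}) :=
  (\int[iid_law (sample_law c ws null_tilt) n]_D
     (cell_loss i0 c (w ord0) l ws fhat e j D * (likelihood (p e) D)%:E))%E.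
have bl e : bounded_tilt (bump l e) := bounded_bump m_gt0 l01 e.
have p0 e z : 0 <= p e z by exact: sample_density_ge0.
apply: (@assouad_average _ _ _ r).
- move=> j e; apply: integral_ge0 => z _.
  by rewrite mule_ge0// ?cell_loss_ge0// lee_fin likelihood_ge0.
- move=> e; apply: le_trans (cell_risk_le i0 c (w ord0) ws m_gt0 l01 e est) _.
  apply: ereal_sup_ubound; exists (sample_law c ws (bump l e)).
  exists (ffair i0 c (w ord0) (bump l e)); split => //.
    apply: lipschitz_class_sample_law => // v v'.
    apply: le_trans (bump_lipschitz e v v' m_gt0 (ltW l_gt0)) _.
    by rewrite ler_wpM2r.
  exact: optimal_ffair.
move=> j e.
apply: (two_point_bound (x := l ^+ 2 / (4 * m%:R ^+ 3)) (g := overlap i0 l e j)).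
- exact: measurable_sample_density.
- exact: measurable_sample_density.
- exact: measurable_overlap.
- exact: p0.
- exact: p0.
- by move=> z; have [] := overlap_spec i0 m_gt0 l01 e j z.
- by move=> z; have [] := overlap_spec i0 m_gt0 l01 e j z.
- exact: integral_sample_density.
- exact: integral_sample_density.
- exact: integral_overlap.
- have m1 : 1 <= m%:R ^+ 3 :> R by rewrite exprn_ege1// ler1n.
  rewrite divr_ge0 ?sqr_ge0 ?mulr_ge0 ?exprn_ge0//= ler_pdivrMr ?mulr_gt0 ?exprn_gt0//.
  by rewrite mul1r; have : l ^+ 2 <= 1; [rewrite expr_le1// ltW|lra].
(* The number of cells is chosen for this: n l^2 / (4 m^3) <= 1/4. *)
- have nm3 : n%:R <= m%:R ^+ 3 :> R by rewrite -natrX ler_nat.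
  rewrite mulrA ler_pdivrMr ?mulr_gt0 ?exprn_gt0//.
  have l2 : l ^+ 2 <= 1 by rewrite expr_le1// ltW.
  have := sqr_ge0 l; have : 0 <= n%:R :> R by []; nra.
- exact: D_ge0.
- exact: measurable_cell_loss.
- exact: measurable_cell_loss.
- by move=> t; exact: cell_loss_ge0.
- by move=> t; exact: cell_loss_ge0.
- by move=> t; apply: cell_loss_pair => //; rewrite l_gt0.
Qed.

(** Take the least [m] with n <= m^3: its predecessor is below the cube root of [n], which is itself
    at least 1 and absorbs the rounding. *)
Lemma exists_cube_root_approx (R : realType) (n : nat) : (0 < n)%N ->
  exists m, [/\ (0 < m)%N, (n <= m ^ 3)%N & m%:R <= 2 * n%:R `^ 3^-1 :> R].
Proof.
move=> n_gt0.
have ex : exists m, (n <= m ^ 3)%N by exists n; rewrite -{1}(expn1 n) leq_pexp2l.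
have t1 : 1 <= n%:R `^ 3^-1 :> R.
  by rewrite -[leLHS](powRr0 n%:R) ler_powR ?ler1n// invr_ge0.
have t3 : (n%:R `^ 3^-1) ^+ 3 = n%:R :> R.
  by rewrite -powR_mulrn ?powR_ge0// -powRrM mulVf// powRr1.
case: (ex_minnP ex) => -[|m] nm min_m; first by move: n_gt0; rewrite ltnNge nm.
exists m.+1; split=> //; rewrite -natr1.
have mt : m%:R < n%:R `^ 3^-1 :> R.
  rewrite ltNge; apply/negP => tm.
  have : (n <= m ^ 3)%N.
    by rewrite -(ler_nat R) natrX -[leLHS]t3 lerXn2r ?nnegrE ?powR_ge0.
  by move/min_m; rewrite ltnn.
lra.
Qed.

Theorem theorem3 (R : realType) (k : nat) (w : 'I_k.+2 -> R) (M L : R)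
    (M_gt0 : 0 < M) (L_gt0 : 0 < L) (w_gt0 : forall s, 0 < w s)
    (w_sum1 : \sum_s w s = 1) :
  exists2 C : R, 0 < C &
    forall d n : nat, (1 <= d)%N -> (1 <= n)%N ->
      ((C * n%:R `^ (- 3^-1))%:E <= @minimax_risk R d k w M L n)%E.
Proof.
have w_lt1 : w ord0 < 1.
  rewrite -w_sum1 2!big_ord_recl addrA.
  apply: (@lt_le_trans _ _ (w ord0 + w (lift ord0 ord0))); first by rewrite ltrDl.
  by rewrite lerDl sumr_ge0// => i _; exact: ltW.
(* [L / 2] because [bump] is 2l-Lipschitz; the cap ensures [l <= 1] when [L] is large. *)
pose l := Num.min (2^-1 : R) (L / 2).
have l_gt0 : 0 < l by rewrite lt_min invr_gt0 ltr0n divr_gt0.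
have l_le : l <= 2^-1 by rewrite ge_min lexx.
have lL : 2 * l <= L by have : l <= L / 2 by [rewrite ge_min lexx orbT]; lra.
pose A := (M / 2 * w ord0) ^+ 2 * (1 - w ord0) * l.
have A_gt0 : 0 < A by rewrite !mulr_gt0 ?exprn_gt0 ?mulr_gt0 ?divr_gt0 ?subr_gt0.
(* 128 from [worst_risk_ge], times 2 for the rounding of the cube root. *)
exists (A / 256); first by rewrite divr_gt0 ?ltr0n.
move=> d n d_gt0 n_gt0; apply/ereal_infP => _ [fhat est <-].
have [ws wsw] := exists_attribute_law (fun s => ltW (w_gt0 s)) w_sum1.
have [m [m_gt0 nm mt]] := exists_cube_root_approx R n_gt0.
have m0 : 0 < m%:R :> R by rewrite ltr0n.
have l01 : 0 < l <= 1 by rewrite l_gt0/=; lra.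
have c_gt0 : 0 < M / 2 by rewrite divr_gt0.
have -> : M = 2 * (M / 2) by field.
apply: (le_trans _ (worst_risk_ge (Ordinal d_gt0) wsw w_gt0 w_sum1 w_lt1 c_gt0 l01
  lL m_gt0 nm est)).
rewrite lee_fin -/A powRN.
set t := n%:R `^ 3^-1 in mt *.
have t0 : 0 < t by lra.
rewrite -mulrA ler_pM2l// -invfM.
have tm : 128 * m%:R <= 256 * t by lra.
have m128 : 0 < 128 * m%:R :> R by rewrite mulr_gt0.
by rewrite lef_pV2 ?posrE ?(lt_le_trans m128 tm).
Qed.
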